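(* For every integer $d\ge 1$ there is a constant $c_d$, depending only on $d$, such that the following holds. Let $X$ be a finite $d$-dimensional simplicial complex on a vertex set $V$ with $|V|=n$, and suppose that for every $0\le j\le d-1$, $X$ is a $(j,k_j,\varepsilon_j)$-expander. Then for all pairwise disjoint sets of vertices $A_0,\ldots,A_d\subseteq V$, \[ \left|\,|F(A_0,\ldots,A_d)|-\frac{k_0k_1\cdots k_{d-1}}{n^{d}}|A_0|\cdots|A_d|\,\right|\le c_d\,k_0k_1\cdots k_{d-1}\,(\varepsilon_0+\cdots+\varepsilon_{d-1})\max_i|A_i|. \]
   Context: Let $X$ be a finite simplicial complex of dimension $d$ with vertex set $V$, $|V|=n$. For $-1\le j\le d$, $X^j$ is the set of $j$-cells of $X$ (cells with $j+1$ vertices; $X^{-1}=\{\varnothing\}$), and $X^j_\pm$ is the set of oriented $j$-cells (orderings of the vertices of a $j$-cell up to even permutations). $\Omega^j$ is the real vector space of functions $f:X^j_\pm\to\mathbb R$ with $f(\bar\sigma)=-f(\sigma)$, where $\bar\sigma$ is $\sigma$ with the opposite orientation (so $\Omega^0=\mathbb R^V$, $\Omega^{-1}\cong\mathbb R$), with inner product $\langle f,g\rangle=\sum_{\sigma\in X^j}f(\sigma)g(\sigma)$. The boundary operator $\partial_j:\Omega^j\to\Omega^{j-1}$ is $(\partial_j f)(\sigma)=\sum_{v:\,v\cup\sigma\in X^j}f(v\sigma)$, where $v\sigma$ is the oriented $j$-cell obtained by prepending the vertex $v$ to the oriented $(j-1)$-cell $\sigma$. Let $\delta_j=\partial_j^*:\Omega^{j-1}\to\Omega^j$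 be its adjoint, $Z_j=\ker\partial_j\subseteq\Omega^j$, and the upper Laplacian $\Delta_j^+=\partial_{j+1}\delta_{j+1}:\Omega^j\to\Omega^j$ (which maps $Z_j$ into itself). The nontrivial spectrum of $\Delta_j^+$ is the spectrum of the restriction $\Delta_j^+|_{Z_j}$. $X$ is a $(j,k,\varepsilon)$-expander if $\varepsilon<1$ and the spectrum of $\Delta_j^+|_{Z_j}$ is contained in $[k(1-\varepsilon),k(1+\varepsilon)]$. For pairwise disjoint $A_0,\ldots,A_j\subseteq V$, $F(A_0,\ldots,A_j)$ denotes the set of $j$-cells of $X$ having exactly one vertex in each $A_i$.
   Formalization: The definition of a (j,k,ε)-expander is taken with 0 ≤ ε < 1 rather than only ε < 1; without this, negative k_j with ε_j < -1 would be allowed and could make the right-hand side negative. For k_j ≥ 0 the condition ε_j ≥ 0 is automatic. *)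

(* Defs.v *)
From HB Require Import structures.
From mathcomp Require Import all_boot all_order all_fingroup all_algebra.
From mathcomp Require Import boolp classical_sets reals.

Set Implicit Arguments.
Unset Strict Implicit.
Unset Printing Implicit Defensive.

Import Order.TTheory GRing.Theory Num.Theory.

Local Open Scope ring_scope.

(* A finite abstract simplicial complex whose vertex set is the whole of V
   (so that Omega^0 = R^V); the empty cell is included. *)
Record complex (V : finType) := Complex {
  cells :> {set {set V}};
  cells_set0 : finset.set0 \in cells;
  cells_vertex : forall v : V, [set v]%SET \in cells;
  cells_closed : forall s t : {set V}, s \in cells -> t \subset s -> t \in cells
}.

Definition has_dim (V : finType) (X : complex V) (d : nat) : Prop :=
  (forall s, s \in X -> (#|s| <= d.+1)%N) /\ (exists2 s, s \in X & #|s| = d.+1).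

(* Forms are indexed by the number m = j + 1 of vertices of a j-cell, so that
   m = 0 is the empty cell.  A function on oriented j-cells is encoded as a
   function on the orderings of (j+1)-element cells which is invariant under
   even reorderings and changes sign under odd ones; it is extended by 0 to the
   tuples which are not orderings of a cell. *)
Definition ordered_cell (V : finType) (X : complex V) (m : nat)
    (t : m.-tuple V) : bool :=
  uniq t && ([set x in t]%SET \in X).

Definition reorder (V : finType) (m : nat) (p : 'S_m) (t : m.-tuple V) :
    m.-tuple V :=
  [tuple tnth t (p i) | i < m].

Notation form R V m := {ffun m.-tuple V -> R^o}.

(* Omega X j.+1 is Omega^j. *)
Definition Omega (R : realType) (V : finType) (X : complex V) (m : nat) :
    set (form R V m) :=
  [set f | (forall t, ~~ ordered_cell X t -> f t = 0) /\
           (forall (p : 'S_m) t, f (reorder p t) = (-1) ^+ p * f t)].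
Arguments Omega {R V} X m.

(* The value of a form on a cell, for the orientation given by the enumeration
   of V; the default 0 is not used when #|s| = m. *)
Definition at_cell (R : realType) (V : finType) (m : nat) (f : form R V m)
    (s : {set V}) : R :=
  oapp (f : m.-tuple V -> R) 0 (insub (enum s)).

(* The product f(s) g(s) does not depend on the orientation chosen for s. *)
Definition dot (R : realType) (V : finType) (X : complex V) (m : nat)
    (f g : form R V m) : R :=
  \sum_(s in X | #|s| == m) at_cell f s * at_cell g s.

(* boundary X (m := j) : Omega^j -> Omega^(j-1). *)
Definition boundary (R : realType) (V : finType) (X : complex V) (m : nat)
    (f : form R V m.+1) : form R V m :=
  [ffun t => if ordered_cell X t then
               \sum_(v | ordered_cell X [tuple of v :: t]) f [tuple of v :: t]
             else 0].

Definition adjoint_value (R : realType) (V : finType) (X : complex V) (m : nat)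
    (f : form R V m) : set (form R V m.+1) :=
  [set g | Omega X m.+1 g /\
           forall h, Omega X m.+1 h -> dot X (boundary X h) f = dot X h g].

(* The adjoint of boundary; adjoint_value X f is a singleton by
   coboundaryP and coboundary_uniq below. *)
Definition coboundary (R : realType) (V : finType) (X : complex V) (m : nat)
    (f : form R V m) : form R V m.+1 :=
  xget 0 (adjoint_value X f).

(* up_laplacian X (m := j.+1) is the upper Laplacian on Omega^j. *)
Definition up_laplacian (R : realType) (V : finType) (X : complex V) (m : nat)
    (f : form R V m) : form R V m :=
  boundary X (coboundary X f).

(* cycles X j is Z_j, the kernel of the boundary Omega^j -> Omega^(j-1). *)
Definition cycles (R : realType) (V : finType) (X : complex V) (j : nat) :
    set (form R V j.+1) :=
  [set f | Omega X j.+1 f /\ boundary X f = 0].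
Arguments cycles {R V} X j.

Definition nontrivial_spectrum (R : realType) (V : finType) (X : complex V)
    (j : nat) : set R :=
  [set lambda | exists f : form R V j.+1,
     [/\ cycles X j f, f <> 0 & up_laplacian X f = lambda *: f]].
Arguments nontrivial_spectrum {R V} X j.

(* eps >= 0 is part of the definition: with eps <= -1 and k < 0 the interval
   contains nonnegative numbers, and the product of the k's times the sum of
   the eps's could then be negative in the mixing bound.  No sign is imposed
   on k. *)
Definition expander (R : realType) (V : finType) (X : complex V) (j : nat)
    (k eps : R) : Prop :=
  (0 <= eps < 1) /\
  (forall lambda, nontrivial_spectrum X j lambda ->
     k * (1 - eps) <= lambda <= k * (1 + eps)).

Definition transversal_cells (V : finType) (X : complex V) (j : nat)
    (A : 'I_j.+1 -> {set V}) : {set {set V}} :=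
  [set s in X | (#|s| == j.+1) && [forall i, #|s :&: A i| == 1%N]]%SET.

Section Adjoint.
Variables (R : realType) (V : finType) (X : complex V).
Implicit Types (m : nat).

Lemma reorderM m (p q : 'S_m) (t : m.-tuple V) :
  reorder q (reorder p t) = reorder (q * p)%g t.
Proof. by apply: eq_from_tnth => i; rewrite !tnth_mktuple permM. Qed.

Lemma reorder1 m (t : m.-tuple V) : reorder 1%g t = t.
Proof. by apply: eq_from_tnth => i; rewrite tnth_mktuple perm1. Qed.

Lemma reorder_perm m (p : 'S_m) (t : m.-tuple V) : perm_eq (reorder p t) t.
Proof. by apply/tuple_permP; exists p. Qed.

Lemma reorder_inj m (t : m.-tuple V) : uniq t -> injective (@reorder V m ^~ t).
Proof.
move=> ut p q e; apply/permP => i; apply: (elimT (tuple_uniqP t) ut).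
by move: e => /(congr1 (fun u => tnth u i)); rewrite !tnth_mktuple.
Qed.

Lemma ordered_cell_perm m (t u : m.-tuple V) :
  perm_eq t u -> ordered_cell X t = ordered_cell X u.
Proof.
move=> tu; rewrite /ordered_cell (perm_uniq tu).
have -> // : [set x in t]%SET = [set x in u]%SET.
by apply/setP => x; rewrite !inE (perm_mem tu).
Qed.

Lemma at_cellE m (f : form R V m) (s : {set V}) (t : m.-tuple V) :
  tval t = enum s -> at_cell f s = f t.
Proof. by move=> e; rewrite /at_cell -e valK. Qed.

Lemma enum_tuple m (s : {set V}) :
  #|s| == m -> exists t : m.-tuple V, tval t = enum s.
Proof.
move=> /eqP sm.
have e : size (enum s) == m by rewrite -cardE sm.
by exists (Tuple e).
Qed.

Lemma enum_ordered_cell m (s : {set V}) (t : m.-tuple V) :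
  s \in X -> tval t = enum s -> ordered_cell X t.
Proof.
move=> sX e; rewrite /ordered_cell e enum_uniq /=.
suff -> : [set x in t]%SET = s by [].
by apply/setP => x; rewrite inE -[RHS]mem_enum -e.
Qed.

Definition elem_form m (w : seq V) : form R V m :=
  [ffun u => \sum_(p : 'S_m | tval (reorder p u) == w) (-1) ^+ p].

Lemma elem_form_reorder m (w : seq V) (q : 'S_m) (u : m.-tuple V) :
  elem_form m w (reorder q u) = (-1) ^+ q * elem_form m w u.
Proof.
rewrite !ffunE mulr_sumr (reindex_inj (mulIg (q^-1)%g)).
apply: eq_big => p; first by rewrite reorderM mulgKV.
by rewrite odd_permM odd_permV signr_addb mulrC.
Qed.

Lemma elem_form_reorderl m (t : m.-tuple V) (q : 'S_m) :
  elem_form m (reorder q t) = (-1) ^+ q *: elem_form m t.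
Proof.
apply/ffunP => u; rewrite !ffunE [RHS]mulr_sumr.
rewrite (reindex_inj (mulgI q)).
apply: eq_big => p; last by rewrite odd_permM signr_addb.
rewrite -reorderM !val_eqE; apply/eqP/eqP => [e|->//].
have := congr1 (reorder q^-1%g) e.
by rewrite !reorderM ?mulgA !mulVg ?mul1g reorder1.
Qed.

Lemma Omega_elem m (t : m.-tuple V) :
  ordered_cell X t -> Omega X m (elem_form m t).
Proof.
move=> ct; split=> [u cu|p u]; last exact: elem_form_reorder.
rewrite ffunE big1 // => p /eqP e.
by case/negP: cu; rewrite -(ordered_cell_perm (reorder_perm p u)) (val_inj e).
Qed.

Lemma Omega_sum m (h : form R V m) : Omega X m h ->
  h = \sum_(s in X | #|s| == m) at_cell h s *: elem_form m (enum s).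
Proof.
move=> [h0 hp]; apply/ffunP => u; rewrite sum_ffunE.
case: (boolP (ordered_cell X u)) => cu; last first.
  rewrite (h0 _ cu) big1 // => s /andP[sX sm].
  have [t te] := enum_tuple sm.
  rewrite ffunE -te (Omega_elem (enum_ordered_cell sX te)).1 //.
  exact: mulr0.
have /andP[uu uX] := cu.
pose s0 : {set V} := [set x in u]%SET.
have s0m : #|s0| == m by rewrite cardsE (card_uniqP uu) size_tuple.
have [t te] := enum_tuple s0m.
have tu : perm_eq t u.
  rewrite te uniq_perm ?enum_uniq // => x.
  by rewrite mem_enum inE.
have [p tp] := tuple_permP tu.
have {}tp : t = reorder p u by apply: val_inj.
rewrite (bigD1 s0) /=; last by rewrite uX.
rewrite [X in _ + X]big1 ?addr0; last first.
  move=> s /andP[/andP[sX sm] /eqP ns].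
  have [w we] := enum_tuple sm.
  rewrite !ffunE big1 ?scaler0 // => q /eqP e.
  case: ns; apply/setP => x.
  by rewrite -mem_enum -e (perm_mem (reorder_perm q u)) inE.
rewrite !ffunE (at_cellE _ te) -te (bigD1 p) /= ?tp ?eqxx //.
rewrite big1 ?addr0; last first.
  move=> q /andP[/eqP e /eqP]; case.
  by apply: (reorder_inj uu); apply: val_inj.
rewrite hp /GRing.scale/= mulrAC -expr2 sqrr_sign.
by rewrite mul1r.
Qed.

Lemma boundaryP m : linear (@boundary R V X m).
Proof.
move=> a f g; apply/ffunP => t; rewrite !ffunE.
case: ifP => _; last by rewrite scaler0 addr0.
rewrite scaler_sumr -big_split; apply: eq_bigr => v _.
by rewrite !ffunE.
Qed.

Lemma at_cellP m s a (f g : form R V m) :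
  at_cell (a *: f + g) s = a * at_cell f s + at_cell g s.
Proof.
by rewrite /at_cell; case: insub => [t|] /=; rewrite ?ffunE // mulr0 addr0.
Qed.

Lemma dotP m a (f g h : form R V m) :
  dot X (a *: f + g) h = a * dot X f h + dot X g h.
Proof.
rewrite /dot mulr_sumr -big_split; apply: eq_bigr => s _ /=.
by rewrite at_cellP mulrDl mulrA.
Qed.

Lemma adjoint_exists m (f : form R V m) : exists g, adjoint_value X f g.
Proof.
pose g : form R V m.+1 := [ffun t =>
  if ordered_cell X t then dot X (boundary X (elem_form m.+1 t)) f else 0].
pose L h := dot X (boundary X h) f.
have LP a h1 h2 : L (a *: h1 + h2) = a * L h1 + L h2.
  by rewrite /L boundaryP dotP.
have L0 : L 0 = 0.
  by have := LP (-1) 0 0; rewrite scaler0 addr0 mulN1r addNr.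
have LZ a h : L (a *: h) = a * L h.
  by rewrite -[_ *: _]addr0 LP L0 addr0.
have LD h1 h2 : L (h1 + h2) = L h1 + L h2.
  by rewrite -[h1]scale1r LP mul1r scale1r.
exists g; split; first split.
- by move=> t /negbTE ct; rewrite ffunE ct.
- move=> p t; rewrite !ffunE (ordered_cell_perm (reorder_perm p t)).
  case: ifP => _; last by rewrite mulr0.
  by rewrite elem_form_reorderl; exact: LZ.
move=> h Oh; rewrite -/(L h) {1}(Omega_sum Oh) (big_morph L LD L0).
apply: eq_bigr => s /andP[sX sm]; rewrite LZ; congr (_ * _).
have [t te] := enum_tuple sm.
by rewrite (at_cellE g te) ffunE (enum_ordered_cell sX te) /L te.
Qed.

Lemma coboundaryP m (f : form R V m) : adjoint_value X f (coboundary X f).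
Proof. exact: xgetPex (adjoint_exists f). Qed.

Lemma coboundary_uniq m (f : form R V m) g :
  adjoint_value X f g -> g = coboundary X f.
Proof.
have [O' a'] := coboundaryP f; set g' := coboundary X f in O' a' *.
move=> [O a].
suff E s : s \in X -> #|s| == m.+1 -> at_cell g s = at_cell g' s.
  rewrite (Omega_sum O) (Omega_sum O').
  by apply: eq_bigr => s /andP[sX sm]; rewrite E.
have dg h : Omega X m.+1 h -> dot X h g = dot X h g' by move=> Oh; rewrite -a // a'.
have dB : dot X (-1 *: g' + g) (-1 *: g' + g) = 0.
  have e h : dot X h (-1 *: g' + g) = - dot X h g' + dot X h g.
    rewrite /dot -sumrN -big_split; apply: eq_bigr => s' _ /=.
    by rewrite at_cellP mulrDr mulN1r mulrN.
  by rewrite e !dotP !(dg _ O) !(dg _ O') addNr.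
move=> sX sm; apply/eqP; rewrite -subr_eq0; apply/eqP.
have {}dB : \sum_(s in X | #|s| == m.+1) at_cell (-1 *: g' + g) s ^+ 2 == 0.
  by rewrite -{2}dB; apply/eqP; apply: eq_bigr => s' _; rewrite expr2.
rewrite psumr_eq0 in dB; last by move=> i _; exact: sqr_ge0.
have := allP dB s (mem_index_enum _); rewrite sX sm /= sqrf_eq0 at_cellP.
by rewrite mulN1r addrC => /eqP.
Qed.

End Adjoint.

(* Main.v *)
From mathcomp Require Import all_boot all_order all_fingroup all_algebra.
From mathcomp Require Import boolp classical_sets reals.
From mathcomp Require Import ring lra zify.
From mathcomp Require complex.
Require Import Defs.
Import Order.TTheory GRing.Theory Num.Theory.
Local Open Scope ring_scope.

(* Work on functions on m-tuples of vertices supported on the window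
   A_i x ... x A_{i+m-1}.  If E (extend) appends a vertex and D
   (drop_first) forgets the first one, then U = D E (up_step) counts steps
   between m-cells through an (m+1)-cell and T = E D (down_step, one size up)
   steps through a common face.  Up to sign, U and T are the
   off-diagonal blocks, between consecutive windows, of the upper and lower
   Laplacians.  The Laplacian Delta^+ + (k_j / k_{j-1}) Delta^- is within
   k_j max(eps_j, eps_{j-1}) of k_j times the identity, and the identity has no
   such block because the A_i are disjoint; hence U is close to
   (k_j / k_{j-1}) T.  Iterating, the total mass of U^N is close to
   (k_j / k_{j-1})^N times that of T^N, which is the total mass of U^(N+1) one
   size down.  Descending from size d to size 0 replaces the number of
   transversal cells by the product of the #|A i|. *)

Set Implicit Arguments.
Unset Strict Implicit.
Unset Printing Implicit Defensive.

(** The expander hypothesis controls Delta^+ only on Z_j. On the orthogonal complement, made of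
    coboundaries, Delta^+ is zero, so alone it is far from a multiple of the identity. There the
    lower Laplacian takes over: it vanishes on Z_j, and its other eigenvalues are eigenvalues of the
    upper Laplacian one dimension down, close to k_{j-1}, which the weight k_j / k_{j-1} moves to
    k_j. In dimension -1 the upper Laplacian is n times the identity; this gives k_{-1} = n,
    eps_{-1} = 0 and the power of n in the main term. U and T are compared in the Euclidean norm,
    and a total mass is a pairing with the indicator of a window. Cauchy-Schwarz therefore costs the
    number of cells in a window, itself at most 2^j k_0 ... k_{j-1} max #|A i|: hence the maximum in
    the error term. The powers of 2 come from bounding U and the weighted T crudely by 2 k_j. *)

Section Spectral.
Import complex.

(** Over the complex numbers the matrix is Hermitian, hence unitarily diagonalizable with real
    diagonal [D]. In the coordinates [w] the form is the sum of the [D 0 i] times the squared moduli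
    of [w 0 i]. Row [i] of the unitary matrix is an eigenvector for [D 0 i], which brings [D 0 i]
    under the hypothesis on [A]. *)
Lemma symmetric_mx_rayleigh_le (R : rcfType) n (A : 'M[R]_n) (b : R) :
  A^T = A -> (forall a, eigenvalue A a -> a <= b) ->
  forall u : 'rV_n, (u *m A *m u^T) 0 0 <= b * (u *m u^T) 0 0.
Proof.
move=> As Ab u; pose C := R[i]%C.
pose f : {rmorphism R -> C} := real_complex R.
have Asym : map_mx f A \is hermsymmx.
  apply: realsym_hermsym.
    by apply/is_hermitianmxP; rewrite expr0 scale1r map_mx_id // map_trmx As.
  by apply/mxOverP => i j; rewrite mxE; apply/complex_realP; exists (A i j).
have Anorm := hermitian_normalmx Asym.
have Dreal := hermitian_spectral_diag_real Asym.
have Aspec := orthomx_spectralP Anorm.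
set P := spectralmx _ in Aspec; set D := spectral_diag _ in Dreal Aspec.
have Punit : P \in unitmx by exact: spectral_unit.
have Pinv : invmx P = (P ^t Num.Def.conjC)%sesqui.
  by apply: invmx_unitary; exact: spectral_unitarymx.
have Db i : D 0 i <= f b.
  have /complex_realP[x Dx] : D 0 i \is Num.real by exact: (mxOverP Dreal).
  rewrite Dx lecR; apply: Ab; rewrite -(eigenvalue_map f) -[f x]Dx.
  apply/eigenvalueP; exists (row i P).
    rewrite {1}Aspec -row_mul !mulmxA mulmxV // mul1mx row_mul.
    rewrite row_diag_mx -scalemxAl -rowE; congr (_ *: _).
  apply: contraTneq Punit => Pi0; apply/negP => Punit.
  have : row i P *m invmx P = 0 by rewrite Pi0 mul0mx.
  rewrite -row_mul mulmxV // => /rowP/(_ i); rewrite !mxE eqxx => /eqP.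
  by rewrite oner_eq0.
pose w := map_mx f u *m invmx P.
have wE : P *m map_mx f u^T = (w ^t Num.Def.conjC)%sesqui.
  rewrite /w Pinv trmx_mul map_mxM /= map_trmx trmxK -map_mx_comp.
  rewrite (map_mx_id (@conjCK _)); apply: (congr1 (mulmx P)).
  by apply/matrixP => i j; rewrite !mxE; apply/esym/conjc_real.
have uA : f ((u *m A *m u^T) 0 0) = \sum_i D 0 i * `|w 0 i| ^+ 2.
  have -> : f ((u *m A *m u^T) 0 0) = (map_mx f (u *m A *m u^T)) 0 0
    by rewrite [RHS]mxE.
  rewrite !map_mxM Aspec !mulmxA -/w -(mulmxA _ P) wE mul_mx_diag mxE.
  by apply: eq_bigr => i _; rewrite !mxE normCK -mulrA mulrCA.
have uu : f ((u *m u^T) 0 0) = \sum_i `|w 0 i| ^+ 2.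
  have -> : f ((u *m u^T) 0 0) = (map_mx f (u *m u^T)) 0 0 by rewrite [RHS]mxE.
  rewrite map_mxM -[map_mx f u](mulmxKV Punit) -/w -mulmxA wE mxE.
  by apply: eq_bigr => i _; rewrite !mxE normCK.
rewrite -lecR -/(f _) uA -[X in _ <= X]/(f _) rmorphM uu mulr_sumr.
by apply: ler_sum => i _; apply: ler_wpM2r; rewrite ?exprn_ge0.
Qed.

End Spectral.

(** * The algebra of forms *)

Section Forms.
Variables (R : realType) (V : finType) (X : complex V).
Implicit Types (m : nat).

Lemma dotC m (f g : form R V m) : dot X f g = dot X g f.
Proof. by apply: eq_bigr => s _; rewrite mulrC. Qed.

Lemma dotPr m a (f g h : form R V m) :
  dot X h (a *: f + g) = a * dot X h f + dot X h g.
Proof. by rewrite dotC dotP !(dotC h). Qed.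

Lemma dot0l m (f : form R V m) : dot X 0 f = 0.
Proof. by have := dotP X (-1) 0 0 f; rewrite scaler0 addr0 mulN1r addNr. Qed.

Lemma dot0r m (f : form R V m) : dot X f 0 = 0.
Proof. by rewrite dotC dot0l. Qed.

Lemma dotZl m a (f g : form R V m) : dot X (a *: f) g = a * dot X f g.
Proof. by rewrite -[_ *: f]addr0 dotP dot0l addr0. Qed.

Lemma dotZr m a (f g : form R V m) : dot X f (a *: g) = a * dot X f g.
Proof. by rewrite dotC dotZl dotC. Qed.

Lemma dot_ge0 m (f : form R V m) : 0 <= dot X f f.
Proof. by apply: sumr_ge0 => s _; rewrite -expr2 sqr_ge0. Qed.

Lemma Omega_linear m a (f g : form R V m) :
  Omega X m f -> Omega X m g -> Omega X m (a *: f + g).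
Proof.
move=> [f0 fp] [g0 gp]; split=> [t ct|p t]; rewrite !ffunE.
  by rewrite f0 // g0 // scaler0 addr0.
by rewrite fp gp mulrDr; congr (_ + _); rewrite /GRing.scale /= mulrCA.
Qed.

Lemma Omega0 m : Omega X m (0 : form R V m).
Proof. by split=> [t _|p t]; rewrite !ffunE ?mulr0. Qed.

Lemma OmegaZ m a (f : form R V m) : Omega X m f -> Omega X m (a *: f).
Proof. by move=> Of; rewrite -[_ *: _]addr0; apply: Omega_linear => //;
  exact: Omega0. Qed.

Lemma OmegaD m (f g : form R V m) :
  Omega X m f -> Omega X m g -> Omega X m (f + g).
Proof. by move=> Of Og; rewrite -[f]scale1r; exact: Omega_linear. Qed.

Lemma Omega_sumr m (I : finType) (P : pred I) (F : I -> form R V m) :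
  (forall i, P i -> Omega X m (F i)) -> Omega X m (\sum_(i | P i) F i).
Proof.
by move=> PF; apply: big_ind => //; [exact: Omega0 | move=> f g; exact: OmegaD].
Qed.

Lemma dot_eq0 m (f : form R V m) : Omega X m f -> dot X f f = 0 -> f = 0.
Proof.
move=> Of /eqP; rewrite /dot psumr_eq0; last first.
  by move=> s _; rewrite -expr2 sqr_ge0.
move=> /allP f0; rewrite (Omega_sum Of) big1 // => s ps.
have := f0 s (mem_index_enum _); rewrite ps /= -expr2 sqrf_eq0 => /eqP->.
by rewrite scale0r.
Qed.

Lemma at_cell_elem m (s s' : {set V}) : #|s| == m -> #|s'| == m ->
  at_cell (elem_form R m (enum s)) s' = (s' == s)%:R.
Proof.
move=> sm sm'; have [t te] := enum_tuple sm; have [t' te'] := enum_tuple sm'.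
rewrite (at_cellE _ te') ffunE; case: eqVneq => [ss'|ss'].
  have ut : uniq t' by rewrite te' enum_uniq.
  rewrite (bigD1 1%g) ?reorder1 ?te' ?ss' ?eqxx // odd_perm1.
  rewrite big1 => [|p]; first by rewrite /= addr0.
  rewrite -ss' -te' => /andP[/eqP e /eqP[]].
  by apply: (reorder_inj ut); rewrite reorder1; apply: val_inj.
rewrite big1 // => p /eqP e; case/eqP: ss'; apply/setP => x.
by rewrite -mem_enum -te' -(perm_mem (reorder_perm p t')) e mem_enum.
Qed.

Lemma coboundary_linear m : linear (@coboundary R V X m).
Proof.
move=> a f g; apply/esym/coboundary_uniq.
have [Of af] := coboundaryP X f; have [Og ag] := coboundaryP X g.
by split=> [|h Oh]; [exact: Omega_linear | rewrite !dotPr af ?ag].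
Qed.

Lemma Omega_coboundary m (f : form R V m) : Omega X m.+1 (coboundary X f).
Proof. by have [] := coboundaryP X f. Qed.

Lemma dot_boundary m (h : form R V m.+1) (f : form R V m) : Omega X m.+1 h ->
  dot X (boundary X h) f = dot X h (coboundary X f).
Proof. by have [_] := coboundaryP X f; exact. Qed.

Lemma ordered_cell_tail m v (t : m.-tuple V) :
  ordered_cell X [tuple of v :: t] -> ordered_cell X t.
Proof.
case/andP=> /= /andP[_ ut] tX; rewrite /ordered_cell ut /=.
by apply: (cells_closed tX); apply/fintype.subsetP => x; rewrite !inE => ->;
  rewrite orbT.
Qed.

Lemma boundaryE m (f : form R V m.+1) t : Omega X m.+1 f ->
  boundary X f t = \sum_v f [tuple of v :: t].
Proof.
move=> [f0 _]; rewrite ffunE; case: ifPn => ct.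
  rewrite [RHS](bigID (fun v => ordered_cell X [tuple of v :: t])) /=.
  by rewrite [X in _ + X]big1 ?addr0 // => v; exact: f0.
by rewrite big1 // => v _; apply: f0; apply: contra ct;
  exact: ordered_cell_tail.
Qed.

Lemma reorder_cons m v (p : 'S_m) (t : m.-tuple V) :
  [tuple of v :: reorder p t] =
  reorder (lift_perm ord0 ord0 p) [tuple of v :: t].
Proof.
apply: eq_from_tnth => i; rewrite tnth_mktuple.
case: (unliftP ord0 i) => [j|] ->; last by rewrite lift_perm_id !tnth0.
by rewrite lift_perm_lift !tnthS tnth_mktuple.
Qed.

Lemma Omega_boundary m (f : form R V m.+1) :
  Omega X m.+1 f -> Omega X m (boundary X f).
Proof.
move=> Of; split=> [t /negbTE ct|p t]; first by rewrite ffunE ct.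
rewrite !boundaryE // mulr_sumr; apply: eq_bigr => v _.
by rewrite reorder_cons (proj2 Of) odd_lift_perm addbb.
Qed.

Lemma reorder_tperm01 m v w (t : m.-tuple V) :
  [tuple of w :: v :: t] =
  reorder (tperm ord0 (lift ord0 ord0)) [tuple of v :: w :: t].
Proof.
apply: eq_from_tnth => i; rewrite tnth_mktuple.
case: (unliftP ord0 i) => [j|] ->; last by rewrite tpermL tnth0 tnthS tnth0.
case: (unliftP ord0 j) => [l|] ->; last by rewrite tpermR tnth0 tnthS tnth0.
by rewrite tpermD //; rewrite !tnthS.
Qed.

Lemma boundary_boundary m (f : form R V m.+2) : Omega X m.+2 f ->
  boundary X (boundary X f) = 0.
Proof.
move=> Of; apply/ffunP => t; rewrite (boundaryE _ (Omega_boundary Of)) ffunE.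
under eq_bigr do rewrite boundaryE //.
set S := \sum_v _; suff SN : S = - S.
  have : S *+ 2 == 0 by rewrite mulr2n {1}SN addNr.
  by rewrite mulrn_eq0 => /eqP.
rewrite {1}/S exchange_big -sumrN; apply: eq_bigr => v _.
rewrite -sumrN; apply: eq_bigr => w _.
by rewrite reorder_tperm01 (proj2 Of) odd_tperm /= expr1 mulN1r.
Qed.

Lemma coboundary_coboundary m (f : form R V m) :
  coboundary X (coboundary X f) = 0.
Proof.
have O2 := Omega_coboundary (coboundary X f).
apply: dot_eq0 => //; rewrite -dot_boundary //.
by rewrite -dot_boundary ?boundary_boundary //;
  [exact: dot0l|exact: Omega_boundary].
Qed.

End Forms.

(** * Rayleigh quotients *)

Section Laplacian.
Variables (R : realType) (V : finType) (X : complex V).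
Implicit Types (m : nat).

Lemma at_cell_sum m (I : finType) (F : I -> form R V m) (s : {set V}) :
  at_cell (\sum_i F i) s = \sum_i at_cell (F i) s.
Proof.
apply: (big_morph (fun f : form R V m => at_cell f s)) => [f g|].
  by rewrite -[f]scale1r at_cellP mul1r scale1r.
by have := at_cellP s (-1) (0 : form R V m) 0;
  rewrite scaler0 addr0 mulN1r addNr.
Qed.

Lemma at_cellZ m a (f : form R V m) (s : {set V}) :
  at_cell (a *: f) s = a * at_cell f s.
Proof.
have z : at_cell (0 : form R V m) s = 0.
  by have := at_cellP s (-1) (0 : form R V m) 0;
    rewrite scaler0 addr0 mulN1r addNr.
by rewrite -[_ *: _]addr0 at_cellP z addr0.
Qed.

(** The elementary forms of the cells are an orthonormal basis of Omega, in which [L] has a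
    symmetric matrix. Outside Omega the form [dot] is degenerate, since it reads a function at one
    ordering of each cell. *)
Lemma Omega_rayleigh_le m (L : form R V m -> form R V m) (b : R) :
  linear L -> (forall f, Omega X m f -> Omega X m (L f)) ->
  (forall f g, Omega X m f -> Omega X m g -> dot X (L f) g = dot X f (L g)) ->
  (forall f lam, Omega X m f -> f <> 0 -> L f = lam *: f -> lam <= b) ->
  forall f, Omega X m f -> dot X (L f) f <= b * dot X f f.
Proof.
move=> Llin LO Lsym Lb.
pose K : {set {set V}} := [set s in X | #|s| == m]%SET.
have KP (i : 'I_#|K|) : enum_val i \in X /\ #|enum_val i| == m.
  by have := enum_valP i; rewrite inE => /andP.
have sumK (F : {set V} -> R) :
    \sum_(s in X | #|s| == m) F s = \sum_(i < #|K|) F (enum_val i).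
  by rewrite -big_enum_val /=; apply: eq_bigl => s; rewrite inE.
have dotK (f g : form R V m) : dot X f g =
    \sum_(i < #|K|) at_cell f (enum_val i) * at_cell g (enum_val i)
      by exact: (sumK (fun s => at_cell f s * at_cell g s)).
pose e (i : 'I_#|K|) : form R V m := elem_form R m (enum (enum_val i)).
have Oe i : Omega X m (e i).
  have [iX im] := KP i; have [t te] := enum_tuple im.
  by rewrite /e -te; apply: Omega_elem; apply: enum_ordered_cell te.
have at_e i j : at_cell (e i) (enum_val j) = (i == j)%:R.
  have [_ im] := KP i; have [_ jm] := KP j.
  by rewrite at_cell_elem // (inj_eq enum_val_inj) eq_sym.
pose F (u : 'rV[R]_#|K|) : form R V m := \sum_i u 0 i *: e i.
have OF u : Omega X m (F u).
  by apply: Omega_sumr => i _; exact: OmegaZ.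
have at_F u j : at_cell (F u) (enum_val j) = u 0 j.
  rewrite at_cell_sum (bigD1 j) //= big1 => [|i ij].
    by rewrite at_cellZ at_e eqxx mulr1 addr0.
  by rewrite at_cellZ at_e (negbTE ij) mulr0.
have FK f : Omega X m f -> f = F (\row_i at_cell f (enum_val i)).
  move=> Of; rewrite {1}(Omega_sum Of).
  rewrite [RHS](eq_bigr (fun i => at_cell f (enum_val i) *: e i)); last first.
    by move=> i _; rewrite mxE.
  rewrite /e -(big_enum_val (fun s =>
    at_cell f s *: elem_form R m (enum s))) /=.
  by apply: eq_bigl => s; rewrite inE.
have LD : {morph L : f g / f + g}.
  by move=> f g; rewrite -{1}[f]scale1r Llin scale1r.
have L0 : L 0 = 0 by have := Llin (-1) 0 0;
  rewrite scaler0 addr0 scaleN1r addNr.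
have LZ a f : L (a *: f) = a *: L f by rewrite -[_ *: f]addr0 Llin L0 addr0.
pose A : 'M[R]_#|K| := \matrix_(i, j) at_cell (L (e i)) (enum_val j).
have AE u j : at_cell (L (F u)) (enum_val j) = (u *m A) 0 j.
  rewrite /F (big_morph L LD L0) at_cell_sum mxE; apply: eq_bigr => i _.
  by rewrite LZ at_cellZ mxE.
have dot_e (f : form R V m) j : dot X f (e j) = at_cell f (enum_val j).
  rewrite dotK (bigD1 j) //= big1 => [|i ij]; rewrite at_e.
    by rewrite eqxx mulr1 addr0.
  by rewrite eq_sym (negbTE ij) mulr0.
have As : A^T = A.
  by apply/matrixP => i j; rewrite !mxE -!dot_e Lsym // dotC.
have Ab a : eigenvalue A a -> a <= b.
  case/eigenvalueP => u uA u0; apply: (Lb (F u)) => //.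
    move=> Fu0; case/eqP: u0; apply/rowP => j.
    by rewrite -at_F Fu0 mxE -[0](scale0r 0) at_cellZ mul0r.
  rewrite (FK _ (LO _ (OF u))) /F scaler_sumr; apply: eq_bigr => i _.
  by rewrite mxE AE uA mxE scalerA.
move=> f Of; have := symmetric_mx_rayleigh_le As Ab (\row_i at_cell f
  (enum_val i)).
set u := \row_i _ => uA.
suff -> : dot X (L f) f = (u *m A *m u^T) 0 0.
  suff -> : dot X f f = (u *m u^T) 0 0 by [].
  by rewrite dotK mxE; apply: eq_bigr => i _; rewrite !mxE.
rewrite dotK [RHS]mxE; apply: eq_bigr => i _.
by rewrite -AE -FK // !mxE.
Qed.

Lemma Omega_rayleigh_ge m (L : form R V m -> form R V m) (b : R) :
  linear L -> (forall f, Omega X m f -> Omega X m (L f)) ->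
  (forall f g, Omega X m f -> Omega X m g -> dot X (L f) g = dot X f (L g)) ->
  (forall f lam, Omega X m f -> f <> 0 -> L f = lam *: f -> b <= lam) ->
  forall f, Omega X m f -> b * dot X f f <= dot X (L f) f.
Proof.
move=> Llin LO Lsym Lb f Of.
have NE (g h : form R V m) : dot X (- g) h = - dot X g h.
  by rewrite -[- g]addr0 -scaleN1r dotP dot0l addr0 mulN1r.
have NO g : Omega X m g -> Omega X m (- g).
  by move=> Og; rewrite -scaleN1r; exact: OmegaZ.
suff : dot X (- L f) f <= - b * dot X f f by rewrite NE mulNr lerN2.
apply: (@Omega_rayleigh_le m (fun f => - L f)) => //.
- by move=> a g h; rewrite Llin opprD scalerN.
- by move=> g Og; exact/NO/LO.
- by move=> g h Og Oh; rewrite NE Lsym // [RHS]dotC NE dotC.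
- move=> g lam Og g0 Lg; rewrite lerNr; apply: (Lb g) => //.
  by rewrite scaleNr -Lg opprK.
Qed.

Lemma dot_up_laplacian m (f g : form R V m) :
  dot X (up_laplacian X f) g = dot X (coboundary X f) (coboundary X g).
Proof. by rewrite dot_boundary //; exact: Omega_coboundary. Qed.

Lemma up_laplacian_linear m : linear (@up_laplacian R V X m).
Proof. by move=> a f g; rewrite /up_laplacian coboundary_linear boundaryP. Qed.

Lemma Omega_up_laplacian m (f : form R V m) : Omega X m (up_laplacian X f).
Proof. by apply: Omega_boundary; exact: Omega_coboundary. Qed.

Lemma cycles_up_laplacian j (f : form R V j.+1) : cycles X j (up_laplacian X f).
Proof.
split; first exact: Omega_up_laplacian.
by apply: boundary_boundary; exact: Omega_coboundary.
Qed.

Lemma up_laplacianZ m a (f : form R V m) :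
  up_laplacian X (a *: f) = a *: up_laplacian X f.
Proof.
have L0 : up_laplacian X 0 = 0 :> form R V m.
  by have := up_laplacian_linear (-1) 0 (0 : form R V m);
    rewrite scaler0 addr0 scaleN1r addNr.
by rewrite -[_ *: _]addr0 up_laplacian_linear L0 addr0.
Qed.

Lemma elem_form_id m (t : m.-tuple V) : uniq t -> elem_form R m t t = 1.
Proof.
move=> ut; rewrite ffunE (big_pred1 1%g) => [|p]; first by rewrite odd_perm1.
rewrite val_eqE; apply/eqP/eqP => [tp|->]; last exact: reorder1.
by apply: (reorder_inj ut); rewrite tp reorder1.
Qed.

Lemma boundary_elem m v (t : m.-tuple V) : ordered_cell X [tuple of v :: t] ->
  boundary X (elem_form R m.+1 [tuple of v :: t]) t = 1.
Proof.
move=> ct; rewrite (boundaryE _ (Omega_elem _ ct)).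
have /andP[uvt _] := ct.
rewrite (bigD1 v) // big1 => [|w wv]; first by rewrite elem_form_id //= addr0.
rewrite ffunE big1 // => p /eqP tp.
have := reorder_perm p [tuple of w :: t]; rewrite tp => /perm_mem/(_ v).
rewrite !inE eqxx /= => /esym/orP[/eqP vw|vt]; first by rewrite vw eqxx in wv.
by move: uvt; rewrite /= vt.
Qed.

(** [expander] puts no sign on [k]. If [k <= 0], an eigenvector for a positive eigenvalue would lie
    in the image of the upper Laplacian, hence in Z_j, and its eigenvalue would be at most
    [k * (1 + eps) <= 0]. So the Laplacian is negative semidefinite, coboundaries of j-forms vanish,
    and by adjointness so does the boundary of an elementary form, against [boundary_elem]. *)
Lemma expander_gt0 j (k eps : R) : expander X j k eps ->
  (exists2 s, s \in X & #|s| = j.+2) -> 0 < k.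
Proof.
move=> [/andP[e0 e1] kP] [s sX /eqP sm]; rewrite ltNge; apply/negP => k0.
have [t te] := enum_tuple sm; case/tupleP: t te => v t te.
pose e : form R V j.+2 := elem_form R j.+2 [tuple of v :: t].
have ct : ordered_cell X [tuple of v :: t] by exact: enum_ordered_cell te.
have Oe : Omega X j.+2 e by exact: Omega_elem.
have up_le0 (f : form R V j.+1) : Omega X j.+1 f ->
  dot X (up_laplacian X f) f <= 0.
  move=> Of; suff : dot X (up_laplacian X f) f <= 0 * dot X f f
    by rewrite mul0r.
  apply: (@Omega_rayleigh_le _ (@up_laplacian R V X j.+1) _ _ _ _ _ _ Of) =>
    {f Of}.
  - exact: up_laplacian_linear.
  - by move=> g _; exact: Omega_up_laplacian.
  - by move=> g h _ _; rewrite dot_up_laplacian dotC -dot_up_laplacian dotC.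
  - move=> g lam Og g0 gE; case: (lerP lam 0) => // lam0.
    have Zg : cycles X j g.
      have <- : lam^-1 *: up_laplacian X g = g
        by rewrite gE scalerA mulVf ?gt_eqF // scale1r.
      rewrite -up_laplacianZ; exact: cycles_up_laplacian.
    have /andP[_] : k * (1 - eps) <= lam <= k * (1 + eps).
      by apply: kP; exists g; split.
    move=> lamk; have ke : k * (1 + eps) <= 0 by rewrite mulr_le0_ge0 //; lra.
    by have := lt_le_trans lam0 (le_trans lamk ke); rewrite ltxx.
have cob0 (f : form R V j.+1) : Omega X j.+1 f -> coboundary X f = 0.
  move=> Of; apply: dot_eq0; first exact: Omega_coboundary.
  by apply/eqP; rewrite eq_le dot_ge0 -dot_up_laplacian up_le0.
have be0 : boundary X e = 0.
  apply: dot_eq0; first exact: Omega_boundary.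
  by rewrite dot_boundary // cob0 ?dot0r //; exact: Omega_boundary.
have := boundary_elem ct; rewrite -/e be0 ffunE => /eqP.
by rewrite eq_sym oner_eq0.
Qed.

End Laplacian.

(** * The weighted Hodge Laplacian *)

(** The upper bound at [f + g] and the lower bound at [-f + g] together isolate [4 * B f g], while
    the cross terms of [G] cancel. This passes from a quadratic form to its off-diagonal blocks. *)
Lemma polarization (R : realFieldType) (E : lmodType R) (S : E -> Prop)
    (B G : E -> E -> R) (c : R) :
  (forall a f g h, B (a *: f + g) h = a * B f h + B g h) ->
  (forall f g, B f g = B g f) ->
  (forall a f g h, G (a *: f + g) h = a * G f h + G g h) ->
  (forall f g, G f g = G g f) ->
  (forall a f g, S f -> S g -> S (a *: f + g)) ->
  (forall f, S f -> `|B f f| <= c * G f f) ->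
  forall f g, S f -> S g -> 2 * B f g <= c * (G f f + G g g).
Proof.
move=> Bl Bs Gl Gs Sl BG f g Sf Sg.
have sq (H : E -> E ->
  R) a : (forall a f g h, H (a *: f + g) h = a * H f h + H g h) ->
    (forall f g, H f g = H g f) ->
    H (a *: f + g) (a *: f + g) = a ^+ 2 * H f f + 2 * a * H f g + H g g.
  move=> Hl Hs; rewrite Hl (Hs f (_ + _)) Hl (Hs g (_ + _)) Hl (Hs g f).
  ring.
have := BG _ (Sl 1 _ _ Sf Sg); have := BG _ (Sl (-1) _ _ Sf Sg).
rewrite !sq // !ler_norml => /andP[h1 h2] /andP[h3 h4].
lra.
Qed.

Section Hodge.
Variables (R : realType) (V : finType) (X : complex V).
Implicit Types (m : nat).

Lemma boundaryZ m a (f : form R V m.+1) :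
  boundary X (a *: f) = a *: boundary X f.
Proof.
have L0 : boundary X 0 = 0 :> form R V m.
  by have := boundaryP X (-1) 0 (0 : form R V m.+1);
    rewrite scaler0 addr0 scaleN1r addNr.
by rewrite -[_ *: f]addr0 boundaryP L0 addr0.
Qed.

Definition hodge_form j (kappa : R) (f g : form R V j.+1) : R :=
  dot X (coboundary X f) (coboundary X g) +
  kappa * dot X (boundary X f) (boundary X g).

Definition hodge_laplacian j (kappa : R) (f : form R V j.+1) : form R V j.+1 :=
  up_laplacian X f + kappa *: coboundary X (boundary X f).

Lemma dot_hodge_laplacian j kappa (f g : form R V j.+1) : Omega X j.+1 g ->
  dot X (hodge_laplacian kappa f) g = hodge_form kappa f g.
Proof.
move=> Og; rewrite /hodge_laplacian addrC dotP dot_up_laplacian addrC.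
by congr (_ + _ * _); rewrite dotC -dot_boundary // dotC.
Qed.

Lemma hodge_laplacian_linear j kappa : linear (@hodge_laplacian j kappa).
Proof.
move=> a f g; rewrite /hodge_laplacian up_laplacian_linear boundaryP.
by rewrite coboundary_linear !scalerDr !scalerA (mulrC a) addrACA.
Qed.

Lemma Omega_hodge_laplacian j kappa (f : form R V j.+1) :
  Omega X j.+1 (hodge_laplacian kappa f).
Proof.
by apply: OmegaD; [exact: Omega_up_laplacian | apply: OmegaZ;
  exact: Omega_coboundary].
Qed.

Lemma hodge_formC j kappa (f g : form R V j.+1) :
  hodge_form kappa f g = hodge_form kappa g f.
Proof. by rewrite /hodge_form dotC [X in _ * X]dotC. Qed.

Lemma hodge_form_linear j kappa a (f g h : form R V j.+1) :
  hodge_form kappa (a *: f + g) h = a * hodge_form kappa f h + hodge_form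
    kappa g h.
Proof. by rewrite /hodge_form coboundary_linear boundaryP !dotP; ring. Qed.

(* An eigenvector of the weighted Hodge Laplacian is sent by the upper Laplacian
   to an eigenvector in Z_j, or, when that image vanishes, by the boundary to an
   eigenvector one dimension lower; this locates the eigenvalue. *)
Lemma hodge_eigenvalue j (k eps k' eps' e : R) (f : form R V j.+1) (lam : R) :
  0 < k -> 0 < k' -> expander X j k eps ->
  (forall (h : form R V j.+1) mu, Omega X j.+1 h -> boundary X h <> 0 ->
     up_laplacian X (boundary X h) = mu *: boundary X h ->
     k' * (1 - eps') <= mu <= k' * (1 + eps')) ->
  eps <= e -> eps' <= e ->
  Omega X j.+1 f -> f <> 0 -> hodge_laplacian (k / k') f = lam *: f ->
  k * (1 - e) <= lam <= k * (1 + e).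
Proof.
move=> k0 k'0 [/andP[eps0 eps1] kP] k'P ee ee' Of f0 Lf.
have weaken mu x d : 0 < x -> d <= e -> x * (1 - d) <= mu <= x * (1 + d) ->
    x * (1 - e) <= mu <= x * (1 + e).
  move=> x0 de /andP[h1 h2]; apply/andP; split.
    by apply: le_trans h1; rewrite ler_pM2l //; lra.
  by apply: le_trans h2 _; rewrite ler_pM2l //; lra.
have [up0|/eqP up0] := eqVneq (up_laplacian X f) 0; last first.
  apply: (weaken _ _ eps) => //; apply: kP.
  exists (up_laplacian X f); split=> //; first exact: cycles_up_laplacian.
  rewrite -up_laplacianZ -Lf /hodge_laplacian addrC up_laplacian_linear.
  rewrite [up_laplacian X (coboundary X _)]/up_laplacian coboundary_coboundary.
  have -> : boundary X (0 : form R V j.+2) = 0.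
    by rewrite -[0](scale0r 0) boundaryZ scale0r.
  by rewrite scaler0 add0r.
move: Lf; rewrite /hodge_laplacian up0 add0r => Lf.
(* If the boundary vanishes too, [f] puts 0 in the nontrivial spectrum, although
   [k * (1 - eps) > 0]. *)
have [b0|/eqP b0] := eqVneq (boundary X f) 0.
  have /andP[h _] : k * (1 - eps) <= 0 <= k * (1 + eps).
    by apply: kP; exists f; split=> //; rewrite up0 scale0r.
  have h' : 0 < k * (1 - eps) by rewrite mulr_gt0 // subr_gt0.
  by have := lt_le_trans h' h; rewrite ltxx.
have kk' : 0 < k / k' by rewrite divr_gt0.
have : k' * (1 - eps') <= lam * (k' / k) <= k' * (1 + eps').
  apply: (k'P f) => //.
  have := congr1 (@boundary R V X j) Lf; rewrite !boundaryZ => bLf.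
  rewrite mulrC -scalerA -bLf scalerA.
  have -> : k' / k * (k / k') = 1 by field; rewrite !gt_eqF.
  by rewrite scale1r.
move/(weaken _ _ _ k'0 ee') => /andP[h1 h2]; apply/andP; split.
  rewrite -(ler_pM2r (divr_gt0 k'0 k0)); apply: le_trans h1.
  by rewrite le_eqVlt; apply/orP; left; apply/eqP; field; rewrite gt_eqF.
rewrite -(ler_pM2r (divr_gt0 k'0 k0)); apply: le_trans h2 _.
by rewrite le_eqVlt; apply/orP; left; apply/eqP; field; rewrite gt_eqF.
Qed.

(** The hypothesis one dimension down speaks of the image of the boundary instead of an [expander],
    so that it also makes sense for [j = 0], where that image consists of forms on the empty
    cell. *)
Lemma hodge_form_bound j (k eps k' eps' e : R) (f : form R V j.+1) :
  0 < k -> 0 < k' -> expander X j k eps ->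
  (forall (h : form R V j.+1) mu, Omega X j.+1 h -> boundary X h <> 0 ->
     up_laplacian X (boundary X h) = mu *: boundary X h ->
     k' * (1 - eps') <= mu <= k' * (1 + eps')) ->
  eps <= e -> eps' <= e -> Omega X j.+1 f ->
  k * (1 - e) * dot X f f <= hodge_form (k / k') f f <= k * (1 + e) * dot X f f.
Proof.
move=> k0 k'0 kP k'P ee ee' Of; rewrite -dot_hodge_laplacian //.
have sym (g h : form R V j.+1) : Omega X j.+1 g -> Omega X j.+1 h ->
    dot X (hodge_laplacian (k / k') g) h = dot X g (hodge_laplacian (k / k') h).
  by move=> Og Oh; rewrite [RHS]dotC !dot_hodge_laplacian // hodge_formC.
apply/andP; split.
  apply: (Omega_rayleigh_ge (L := @hodge_laplacian j (k / k'))) Of => //.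
  - exact: hodge_laplacian_linear.
  - by move=> g _; exact: Omega_hodge_laplacian.
  - by move=> g lam Og g0 Lg;
    have /andP[] := hodge_eigenvalue k0 k'0 kP k'P ee ee' Og g0 Lg.
apply: (Omega_rayleigh_le (L := @hodge_laplacian j (k / k'))) Of => //.
- exact: hodge_laplacian_linear.
- by move=> g _; exact: Omega_hodge_laplacian.
- by move=> g lam Og g0 Lg;
  have /andP[] := hodge_eigenvalue k0 k'0 kP k'P ee ee' Og g0 Lg.
Qed.

End Hodge.

(** * Alternating forms of functions on tuples *)

Lemma sum_neq0_exists (R : nmodType) (I : finType) (F : I -> R) :
  \sum_i F i != 0 -> exists i, F i != 0.
Proof.
case: (pickP (fun i => F i != 0)) => [i Fi _|F0]; first by exists i.
by rewrite big1 ?eqxx // => i _; apply/eqP; have := F0 i; case: eqP.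
Qed.

Section TupleEnds.
Variable V : finType.
Implicit Types m : nat.

Definition snoc m (t : m.-tuple V) (w : V) : m.+1.-tuple V :=
  [tuple if unlift ord_max i is Some j then tnth t j else w | i < m.+1].
Definition front m (u : m.+1.-tuple V) : m.-tuple V :=
  [tuple tnth u (lift ord_max i) | i < m].
Definition tail m (u : m.+1.-tuple V) : m.-tuple V :=
  [tuple tnth u (lift ord0 i) | i < m].

Lemma tnth_snoc_max m (t : m.-tuple V) w : tnth (snoc t w) ord_max = w.
Proof. by rewrite tnth_mktuple unlift_none. Qed.

Lemma tnth_snoc_lift m (t : m.-tuple V) w i :
  tnth (snoc t w) (lift ord_max i) = tnth t i.
Proof. by rewrite tnth_mktuple liftK. Qed.

Lemma front_snoc m (t : m.-tuple V) w : front (snoc t w) = t.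
Proof. by apply: eq_from_tnth => i; rewrite tnth_mktuple tnth_snoc_lift. Qed.

Lemma snoc_front m (u : m.+1.-tuple V) : snoc (front u) (tnth u ord_max) = u.
Proof.
apply: eq_from_tnth => i; case: (unliftP ord_max i) => [j|] ->.
  by rewrite tnth_snoc_lift tnth_mktuple.
by rewrite tnth_snoc_max.
Qed.

Lemma tail_cons m (t : m.-tuple V) v : tail [tuple of v :: t] = t.
Proof. by apply: eq_from_tnth => i; rewrite tnth_mktuple tnthS. Qed.

Lemma cons_tail m (u : m.+1.-tuple V) : [tuple of tnth u ord0 :: tail u] = u.
Proof.
apply: eq_from_tnth => i; case: (unliftP ord0 i) => [j|] ->.
  by rewrite tnthS tnth_mktuple.
by rewrite tnth0.
Qed.

Lemma sum_cons (R : nmodType) m (F : m.+1.-tuple V -> R) :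
  \sum_u F u = \sum_(t : m.-tuple V) \sum_v F [tuple of v :: t].
Proof.
rewrite pair_big /= (reindex (fun p : m.-tuple V * V =>
  [tuple of p.2 :: p.1])) //.
exists (fun u => (tail u, tnth u ord0)) => [[t v] _|u _] /=.
  by rewrite tail_cons tnth0.
exact: cons_tail.
Qed.

Lemma sum_snoc (R : nmodType) m (F : m.+1.-tuple V -> R) :
  \sum_u F u = \sum_(t : m.-tuple V) \sum_w F (snoc t w).
Proof.
rewrite pair_big /= (reindex (fun p : m.-tuple V * V => snoc p.1 p.2)) //.
exists (fun u => (front u, tnth u ord_max)) => [[t v] _|u _] /=.
  by rewrite front_snoc tnth_snoc_max.
exact: snoc_front.
Qed.

Lemma reorder_snoc m (t : m.-tuple V) w :
  reorder (lift_perm ord0 ord_max 1%g) (snoc t w) = [tuple of w :: t].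
Proof.
apply: eq_from_tnth => i; rewrite tnth_mktuple.
case: (unliftP ord0 i) => [j|] ->.
  by rewrite lift_perm_lift perm1 tnth_snoc_lift tnthS.
by rewrite lift_perm_id tnth_snoc_max tnth0.
Qed.

(** This leaves only the identity term in an alternating sum when [u] is constrained at all places
    but the first and its reordering at all places but the last. Disjointness gives [p i = i] when
    [p i > 0] and [i] is not last. Place 0 is settled first; then [p i = 0] with [i > 0] contradicts
    injectivity, and the last place is what remains. *)
Lemma perm_window_id n (B : nat -> {set V}) (u : 'I_n -> V) (p : 'S_n) :
  (forall i j x, x \in B i -> x \in B j -> i = j) ->
  (forall i : 'I_n, (0 < i)%N -> u i \in B i) ->
  (forall i : 'I_n, (i.+1 < n)%N -> u (p i) \in B i) -> p = 1%g.
Proof.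
move=> hB hu hp.
have p0 (i : 'I_n) : i = 0%N :> nat -> (1 < n)%N -> p i = i.
  move=> i0 n1; apply: val_inj; rewrite /= i0.
  have upi : u (p i) \in B 0%N by have := hp i; rewrite i0; exact.
  case: (posnP (p i)) => // pi0; exact: hB (hu _ pi0) upi.
have pS (i : 'I_n) : (i.+1 < n)%N -> p i = i.
  move=> iN; have n1 : (1 < n)%N by lia.
  case: (posnP i) => [i0|i0]; first exact: p0.
  case: (posnP (p i)) => pi0; last first.
    by apply: val_inj; exact: hB (hu _ pi0) (hp _ iN).
  have ppi : p (p i) = p i by exact: p0.
  by move/perm_inj: ppi.
apply/permP => i; rewrite perm1.
case: (ltnP i.+1 n) => [/pS//|iN].
apply/eqP; apply/negPn/negP => pii.
have npi : nat_of_ord (p i) != i by rewrite val_eqE.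
have : p (p i) = p i.
  by apply: pS; move: (ltn_ord i) (ltn_ord (p i)) npi iN; lia.
by move/perm_inj => e; rewrite e eqxx in pii.
Qed.

End TupleEnds.

Section Alternation.
Variables (R : realType) (V : finType) (X : complex V).
Implicit Types m : nat.

Definition cell_supported m (phi : m.-tuple V -> R) :=
  forall t, ~~ ordered_cell X t -> phi t = 0.

(** There is no division by the factorial of [m]: for disjoint [A i], a cell has at most one
    ordering in a given window, so if [phi] lives on that window, [alt phi] extends [phi] and has
    the same norm ([alt_window], [dot_alt_self]). *)
Definition alt m (phi : m.-tuple V -> R) : form R V m :=
  \sum_t phi t *: elem_form R m t.

Lemma altE m (phi : m.-tuple V -> R) u :
  alt phi u = \sum_(p : 'S_m) (-1) ^+ p * phi (reorder p u).
Proof.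
rewrite /alt sum_ffunE.
under eq_bigr => t _ do rewrite !ffunE /GRing.scale /= mulr_sumr.
rewrite (exchange_big_dep xpredT) //=; apply: eq_bigr => p _.
rewrite (big_pred1 (reorder p u)) => [|t]; first by rewrite mulrC.
by rewrite -[RHS]/(t == reorder p u) eq_sym -[RHS]val_eqE.
Qed.

Lemma Omega_alt m (phi : m.-tuple V -> R) : cell_supported phi ->
  Omega X m (alt phi).
Proof.
move=> sphi; apply: Omega_sumr => t _.
case: (boolP (ordered_cell X t)) => ct; last by rewrite sphi // scale0r;
  exact: Omega0.
by apply: OmegaZ; exact: Omega_elem.
Qed.

Lemma dot_elem m (t : m.-tuple V) (g : form R V m) :
  ordered_cell X t -> Omega X m g -> dot X (elem_form R m t) g = g t.
Proof.
move=> ct Og; have /andP[ut tX] := ct.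
pose s : {set V} := [set x in t]%SET.
have sm : #|s| == m by rewrite cardsE (card_uniqP ut) size_tuple.
have [t' te] := enum_tuple sm.
have tt' : perm_eq t t'.
  by rewrite te uniq_perm ?enum_uniq // => x; rewrite mem_enum inE.
have [q tq] := tuple_permP tt'.
have {}tq : t = reorder q t' by apply: val_inj.
rewrite {1}tq elem_form_reorderl dotZl.
rewrite tq (proj2 Og); congr (_ * _); rewrite /dot (bigD1 s) /=;
  last by rewrite tX.
rewrite te at_cell_elem // eqxx mul1r (at_cellE _ te) big1 ?addr0 //.
move=> s' /andP[/andP[_ sm'] ss']; rewrite at_cell_elem // (negbTE ss').
exact: mul0r.
Qed.

Lemma dot_alt m (phi : m.-tuple V -> R) (g : form R V m) :
  cell_supported phi -> Omega X m g -> dot X (alt phi) g = \sum_t phi t * g t.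
Proof.
move=> sphi Og; rewrite /alt.
have D0 : dot X 0 g = 0 by exact: dot0l.
have DD : {morph (fun f => dot X f g) : f h / f + h}.
  by move=> f h /=; rewrite -[f]scale1r dotP mul1r scale1r.
rewrite (big_morph (fun f => dot X f g) DD D0); apply: eq_bigr => t _.
rewrite dotZl.
case: (boolP (ordered_cell X t)) => ct; first by rewrite dot_elem.
by rewrite sphi // !mul0r.
Qed.

Lemma Omega_snoc m (h : form R V m.+1) (t : m.-tuple V) w : Omega X m.+1 h ->
  h [tuple of w :: t] = (-1) ^+ m * h (snoc t w).
Proof.
move=> [_ hp]; rewrite -reorder_snoc hp odd_lift_perm odd_perm1 /= addbF.
by rewrite signr_odd.
Qed.

(** [alt] forgets where the new vertex sits, so the coboundary has two representatives: the vertex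
    is added in front here, at the end in [coboundary_alt_front], whose sign is that of the cyclic
    move. [dot_coboundary_alt] uses one for each argument, so that a single tuple carries both
    windows, as its front and its tail. *)
Lemma coboundary_alt_tail m (phi : m.-tuple V -> R) : cell_supported phi ->
  coboundary X (alt phi) =
  alt (fun u => if ordered_cell X u then phi (tail u) else 0).
Proof.
move=> sphi; pose xi (u : m.+1.-tuple V) : R :=
  if ordered_cell X u then phi (tail u) else 0.
rewrite -/xi.
have sxi : cell_supported xi by move=> u /negbTE cu; rewrite /xi cu.
apply/esym/coboundary_uniq; split=> [|h Oh]; first exact: Omega_alt.
rewrite dotC dot_alt //; last exact: Omega_boundary.
rewrite dotC dot_alt // sum_cons; apply: eq_bigr => t _.
rewrite boundaryE // mulr_sumr; apply: eq_bigr => v _.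
rewrite /xi tail_cons; case: ifPn => // ct.
by rewrite (proj1 Oh) // !mulr0.
Qed.

Lemma coboundary_alt_front m (phi : m.-tuple V -> R) : cell_supported phi ->
  coboundary X (alt phi) =
  (-1) ^+ m *: alt (fun u => if ordered_cell X u then phi (front u) else 0).
Proof.
move=> sphi; pose xi (u : m.+1.-tuple V) : R :=
  if ordered_cell X u then phi (front u) else 0.
rewrite -/xi.
have sxi : cell_supported xi by move=> u /negbTE cu; rewrite /xi cu.
apply/esym/coboundary_uniq; split=> [|h Oh]; first by apply: OmegaZ;
  exact: Omega_alt.
rewrite dotC dot_alt //; last exact: Omega_boundary.
rewrite dotC dotZl dot_alt // sum_snoc mulr_sumr.
apply: eq_bigr => t _.
rewrite boundaryE // !mulr_sumr; apply: eq_bigr => v _.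
rewrite (Omega_snoc _ _ Oh) /xi front_snoc mulrCA; case: ifPn => // ct.
by rewrite (proj1 Oh) // !mulr0.
Qed.

End Alternation.

(** * Windows *)

Section Windows.
Variables (R : realType) (V : finType) (X : complex V) (A : nat -> {set V}).
Hypothesis hA : forall i j x, x \in A i -> x \in A j -> i = j.
Implicit Types m i : nat.

Definition window m i (t : m.-tuple V) : bool :=
  ordered_cell X t && [forall l : 'I_m, tnth t l \in A (i + l)%N].

Definition window_supported m i (phi : m.-tuple V -> R) :=
  forall t, ~~ window i t -> phi t = 0.

Lemma window_neq0 m i (phi : m.-tuple V -> R) t :
  window_supported i phi -> phi t != 0 -> window i t.
Proof. by move=> sphi; apply: contraNT => /sphi ->. Qed.

Lemma window_tnth m i (t : m.-tuple V) (l : 'I_m) :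
  window i t -> tnth t l \in A (i + l)%N.
Proof. by case/andP=> _ /forallP. Qed.

Lemma window_cell m i (t : m.-tuple V) : window i t -> ordered_cell X t.
Proof. by case/andP. Qed.

Lemma window_cell_supported m i (phi : m.-tuple V -> R) :
  window_supported i phi -> cell_supported X phi.
Proof. by move=> sphi t ct; apply: sphi; rewrite /window (negbTE ct). Qed.

Lemma window_cons m i v (t : m.-tuple V) :
  window i [tuple of v :: t] -> window i.+1 t.
Proof.
move=> w; rewrite /window (ordered_cell_tail (window_cell w)) /=.
apply/forallP => l; have := window_tnth (lift ord0 l) w.
by rewrite tnthS /= /bump /= addnCA addSnnS.
Qed.

Lemma ordered_cell_snoc m w (t : m.-tuple V) :
  ordered_cell X (snoc t w) = ordered_cell X [tuple of w :: t].
Proof. by rewrite -reorder_snoc (ordered_cell_perm _ (reorder_perm _ _)). Qed.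

Lemma window_snoc m i w (t : m.-tuple V) : window i (snoc t w) -> window i t.
Proof.
move=> h; have := window_cell h;
  rewrite ordered_cell_snoc => /ordered_cell_tail ct.
rewrite /window ct /=; apply/forallP => l.
have := window_tnth (lift ord_max l) h.
by rewrite tnth_snoc_lift lift_max.
Qed.

Lemma alt_single m (phi : m.-tuple V -> R) u :
  (forall p : 'S_m, phi (reorder p u) != 0 -> p = 1%g) -> alt phi u = phi u.
Proof.
move=> h; rewrite altE (bigD1 1%g) //= big1 => [|p p1].
  by rewrite odd_perm1 reorder1 mul1r addr0.
by case: (eqVneq (phi (reorder p u)) 0) => [->|/h p1'];
  [rewrite mulr0|rewrite p1' eqxx in p1].
Qed.

Lemma alt_window m i (phi : m.-tuple V -> R) t :
  window_supported i phi -> window i t -> alt phi t = phi t.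
Proof.
move=> sphi wt; apply: alt_single => p /(window_neq0 sphi) wp.
apply/permP => l; rewrite perm1; apply: val_inj => /=.
have := window_tnth l wp; rewrite tnth_mktuple => h1.
by have := hA h1 (window_tnth (p l) wt); lia.
Qed.

Lemma dot_alt_self m i (phi : m.-tuple V -> R) :
  window_supported i phi -> dot X (alt phi) (alt phi) = \sum_t phi t ^+ 2.
Proof.
move=> sphi; have sc := window_cell_supported sphi.
rewrite dot_alt //; last exact: Omega_alt.
apply: eq_bigr => t _; case: (boolP (window i t)) => wt.
  by rewrite (alt_window sphi) // expr2.
by rewrite sphi // mul0r expr0n.
Qed.

(** A cell with an ordering in window [i] has a vertex in [A i], for which window [i.+1] has no
    place. The size is positive because the empty tuple lies in every window. *)
Lemma dot_alt_shift j i (phi psi : j.+1.-tuple V -> R) :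
  window_supported i phi -> window_supported i.+1 psi ->
  dot X (alt phi) (alt psi) = 0.
Proof.
move=> sphi spsi.
rewrite dot_alt; [|exact: window_cell_supported sphi|].
  rewrite big1 // => t _; case: (boolP (window i t)) => wt;
    last by rewrite sphi // mul0r.
  rewrite altE big1 ?mulr0 // => p _; rewrite spsi ?mulr0 //; apply/negP => wp.
  have := window_tnth (p^-1%g ord0) wp; rewrite tnth_mktuple permKV => h1.
  by have := hA h1 (window_tnth ord0 wt) => /=; lia.
by apply: Omega_alt; exact: window_cell_supported spsi.
Qed.

Lemma dot_coboundary_alt m i (phi psi : m.-tuple V -> R) :
  window_supported i phi -> window_supported i.+1 psi ->
  dot X (coboundary X (alt phi)) (coboundary X (alt psi)) =
  (-1) ^+ m * \sum_(u | ordered_cell X u) phi (front u) * psi (tail u).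
Proof.
move=> sphi spsi; have sc := window_cell_supported sphi.
have sc' := window_cell_supported spsi.
rewrite dotC {1}(coboundary_alt_tail sc') dot_alt;
  last exact: Omega_coboundary; last first.
  by move=> u /negbTE ->.
rewrite (coboundary_alt_front sc) mulr_sumr [RHS]big_mkcond /=.
apply: eq_bigr => u _; rewrite !ffunE; case: ifPn => cu; last by rewrite mul0r.
case: (boolP (window i.+1 (tail u))) => wu;
  last by rewrite spsi // mul0r !mulr0.
rewrite alt_single => [|p].
  by rewrite cu /GRing.scale /=; ring.
case: ifP => [cp|_]; last by rewrite eqxx.
move/(window_neq0 sphi) => wp.
apply: (@perm_window_id V m.+1 (fun l => A (i + l)%N) (tnth u)).
- by move=> a b x h1 h2; have := hA h1 h2; lia.
- move=> l; case: (unliftP ord0 l) => [l'|] -> // _.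
  by have := window_tnth l' wu;
    rewrite tnth_mktuple /= /bump /= add1n addnS addSn.
- move=> l; case: (unliftP ord_max l) => [l'|] ->; last by rewrite /= ltnn.
  by move=> _; have := window_tnth l' wp; rewrite !tnth_mktuple lift_max.
Qed.

(** Replace [a] by the alternation of its restriction to the window. Both agree on the cells with an
    ordering there, and on the other cells the product with [b] is zero. *)
Lemma dot_window_rep m i (a b : form R V m) :
  Omega X m a -> Omega X m b ->
  (forall t, ordered_cell X t -> a t * b t != 0 ->
     exists2 t' : m.-tuple V, window i t' & perm_eq t' t) ->
  dot X a b = \sum_(t | window i t) a t * b t.
Proof.
move=> Oa Ob rep.
pose chi (t : m.-tuple V) : R := if window i t then a t else 0.
have schi : window_supported i chi by move=> t /negbTE; rewrite /chi => ->.
have sc := window_cell_supported schi.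
have Oc := Omega_alt sc.
transitivity (dot X (alt chi) b); last first.
  rewrite dot_alt // [RHS]big_mkcond; apply: eq_bigr => t _ /=.
  by rewrite /chi; case: ifP => // _; rewrite mul0r.
apply: eq_bigr => s /andP[sX sm]; have [t te] := enum_tuple sm.
rewrite !(at_cellE _ te); have ct := enum_ordered_cell sX te.
case: (pselect (exists2 t' : m.-tuple V, window i t' & perm_eq t' t)) =>
  [[t' wt' tt']|nex].
  have [q tq] : exists q, t = reorder q t'.
    rewrite perm_sym in tt'; have [q tq] := tuple_permP tt'.
    by exists q; apply: val_inj.
  congr (_ * _); rewrite tq (proj2 Oa) (proj2 Oc) (alt_window schi) //.
  by rewrite /chi wt'.
have -> : alt chi t = 0.
  rewrite altE big1 // => p _; rewrite schi ?mulr0 //.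
  by apply: contra_notN nex => wp; exists (reorder p t) => //;
    exact: reorder_perm.
rewrite mul0r; apply/eqP; apply: contra_notT nex => ab; exact: rep.
Qed.

Lemma alt_neq0 m i (phi : m.-tuple V -> R) t : window_supported i phi ->
  alt phi t != 0 -> exists2 t' : m.-tuple V, window i t' & perm_eq t' t.
Proof.
move=> sphi; rewrite altE => /sum_neq0_exists [p].
rewrite mulf_eq0 negb_or => /andP[_ /(window_neq0 sphi) wp].
by exists (reorder p t) => //; exact: reorder_perm.
Qed.

Lemma dot_boundary_alt j i (phi psi : j.+1.-tuple V -> R) :
  window_supported i phi -> window_supported i.+1 psi ->
  dot X (boundary X (alt phi)) (boundary X (alt psi)) =
  (-1) ^+ j * \sum_(r : j.-tuple V)
    (\sum_v phi [tuple of v :: r]) * (\sum_w psi (snoc r w)).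
Proof.
move=> sphi spsi; have Ophi := Omega_alt (window_cell_supported sphi).
have Opsi := Omega_alt (window_cell_supported spsi).
rewrite (@dot_window_rep j i.+1);
  [|exact: Omega_boundary|exact: Omega_boundary|].
  rewrite mulr_sumr [LHS]big_mkcond; apply: eq_bigr => r _.
  case: ifPn => wr; last first.
    rewrite [X in _ * (_ * X)]big1 ?mulr0 // => w _; apply: spsi.
    by apply: contra wr; exact: window_snoc.
  rewrite !boundaryE //.
  have -> : \sum_v alt phi [tuple of v :: r] = \sum_v phi [tuple of v :: r].
    apply: eq_bigr => v _; apply: alt_single => p /(window_neq0 sphi) wp.
    apply: (@perm_window_id V j.+1 (fun l =>
      A (i + l)%N) (tnth [tuple of v :: r])).
    - by move=> a b x h1 h2; have := hA h1 h2; lia.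
    - move=> l; case: (unliftP ord0 l) => [l'|] -> // _.
      by have := window_tnth l' wr; rewrite tnthS /= /bump /= add1n addnS addSn.
    - by move=> l _; have := window_tnth l wp; rewrite tnth_mktuple.
  rewrite mulrCA; congr (_ * _); rewrite mulr_sumr; apply: eq_bigr => w _.
  rewrite (Omega_snoc _ _ Opsi); congr (_ * _).
  apply: alt_single => p /(window_neq0 spsi) wp.
  (* Now the reordered tuple is constrained everywhere and the given one at all places but the last,
     so [perm_window_id] is applied to the inverse permutation. *)
  apply: (can_inj (@invgK _)); rewrite invg1.
  apply: (@perm_window_id V j.+1 (fun l => A (i.+1 + l)%N) (fun l =>
    tnth (snoc r w) (p l))).
  - by move=> a b x h1 h2; have := hA h1 h2; lia.
  - by move=> l _; have := window_tnth l wp; rewrite tnth_mktuple.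
  - move=> l; rewrite permKV; case: (unliftP ord_max l) => [l'|] ->;
    last by rewrite /= ltnn.
    by move=> _; have := window_tnth l' wr; rewrite tnth_snoc_lift lift_max.
(* If both boundaries are nonzero at [r], then [v :: r] has an ordering [u] in window [i] and
   [w :: r] one in window [i.+1]. The first vertex of [u] is in [A i], hence not in [r]; so it is
   [v], and the rest of [u] orders [r] in window [i.+1]. *)
move=> r cr; rewrite mulf_eq0 negb_or !boundaryE // => /andP[].
move=> /sum_neq0_exists[v /(alt_neq0 sphi)[u wu uv]].
move=> /sum_neq0_exists[w /(alt_neq0 spsi)[u' wu' uw]].
case/tupleP: u wu uv => x r' wu uv.
have xA : x \in A i by have := window_tnth ord0 wu; rewrite tnth0 addn0.
exists r'; first exact: window_cons wu.
have xr : x \notin r.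
  apply/negP => xr.
  have : x \in u' by rewrite (perm_mem uw) inE xr orbT.
  by case/tnthP => l xE; have := window_tnth l wu'; rewrite -xE => /(hA xA);
    lia.
have xv : x = v.
  by have := perm_mem uv x; rewrite !inE eqxx (negbTE xr) orbF /= => /esym/eqP.
by move: uv; rewrite xv perm_cons.
Qed.

End Windows.

(** * Steps between consecutive windows *)

Section SquareNorm.
Variables (R : realFieldType) (T : finType).
Implicit Types a b : T -> R.

Lemma cauchy_schwarz_le a b (x y : R) : 0 <= x -> 0 <= y ->
  \sum_t a t ^+ 2 <= x ^+ 2 -> \sum_t b t ^+ 2 <= y ^+ 2 ->
  \sum_t a t * b t <= x * y.
Proof.
have zero (c c' : T -> R) (z : R) : \sum_t c t ^+ 2 <= 0 -> 0 <= z ->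
    \sum_t c t * c' t <= z.
  move=> c0 z0; rewrite big1 // => t _.
  have /eqP : \sum_t c t ^+ 2 = 0.
    by apply/le_anti; rewrite c0 sumr_ge0 // => s _; exact: sqr_ge0.
  rewrite psumr_eq0 => [/allP/(_ t (mem_index_enum _))|s _];
    last exact: sqr_ge0.
  by rewrite /= sqrf_eq0 => /eqP->; rewrite mul0r.
rewrite le_eqVlt => /predU1P[<-|x0].
  by rewrite expr0n /= mul0r => _ a0 _; exact: zero.
rewrite le_eqVlt => /predU1P[<-|y0].
  rewrite expr0n /= mulr0 => _ b0; under eq_bigr do rewrite mulrC; exact: zero.
move=> ax by_.
have xy0 : 0 < x * y by rewrite mulr_gt0.
rewrite -(ler_pM2l xy0) -(ler_pM2l (ltr0n R 2)) //.
have h : 2 * (x * y * \sum_t a t * b t) <=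
    y ^+ 2 * (\sum_t a t ^+ 2) + x ^+ 2 * \sum_t b t ^+ 2.
  rewrite !mulr_sumr -big_split /=; apply: ler_sum => t _.
  rewrite -subr_ge0.
  have -> : y ^+ 2 * a t ^+ 2 + x ^+ 2 * b t ^+ 2 - 2 * (x * y * (a t * b t)) =
            (y * a t - x * b t) ^+ 2 by ring.
  exact: sqr_ge0.
apply: le_trans h _.
have := ler_pM2l (exprn_gt0 2 y0) (\sum_t a t ^+ 2) (x ^+ 2).
have := ler_pM2l (exprn_gt0 2 x0) (\sum_t b t ^+ 2) (y ^+ 2).
rewrite ax by_; set P := _ * _; set Q := _ * _ => h1 h2.
have -> : 2 * (x * y * (x * y)) = y ^+ 2 * x ^+ 2 + x ^+ 2 * y ^+ 2 by ring.
by apply: lerD; rewrite ?h1 ?h2.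
Qed.

Lemma sqnorm_triangle a b (x y : R) : 0 <= x -> 0 <= y ->
  \sum_t a t ^+ 2 <= x ^+ 2 -> \sum_t b t ^+ 2 <= y ^+ 2 ->
  \sum_t (a t + b t) ^+ 2 <= (x + y) ^+ 2.
Proof.
move=> x0 y0 ax by_; have := cauchy_schwarz_le x0 y0 ax by_.
have -> : \sum_t (a t + b t) ^+ 2 =
    \sum_t a t ^+ 2 + 2 * (\sum_t a t * b t) + \sum_t b t ^+ 2.
  by rewrite mulr_sumr -!big_split; apply: eq_bigr => t _ /=; ring.
have -> : (x + y) ^+ 2 = x ^+ 2 + 2 * (x * y) + y ^+ 2 by ring.
lra.
Qed.

(** Meant for [b] the image of [a] under an operator, the left side being the pairing of the image
    of [z * a] with [b]. Take [z = c], or [z = 1] when [c = 0]. *)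
Lemma sqnorm_duality a b (c : R) : 0 <= c ->
  (forall z, 2 * (z * \sum_t b t ^+ 2) <=
     c * (z ^+ 2 * (\sum_t a t ^+ 2) + \sum_t b t ^+ 2)) ->
  \sum_t b t ^+ 2 <= c ^+ 2 * \sum_t a t ^+ 2.
Proof.
rewrite le_eqVlt => /predU1P[<-|c0] h; first by have := h 1; lra.
have := h c; set F := \sum_t a t ^+ 2; set N := \sum_t b t ^+ 2 => hc.
have : c * (2 * N) <= c * (c ^+ 2 * F + N) by lra.
by rewrite ler_pM2l //; lra.
Qed.

End SquareNorm.

Section Operators.
Variables (R : realType) (V : finType) (X : complex V) (A : nat -> {set V}).
Hypothesis hA : forall i j x, x \in A i -> x \in A j -> i = j.
Implicit Types m i : nat.
Local Notation window := (window X A).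
Local Notation supported := (@window_supported R V X A).

Definition drop_first m (phi : m.+1.-tuple V -> R) (r : m.-tuple V) : R :=
  \sum_v phi [tuple of v :: r].
Definition extend m i (phi : m.-tuple V -> R) (u : m.+1.-tuple V) : R :=
  if window i u then phi (front u) else 0.
Definition up_step m i (phi : m.-tuple V -> R) : m.-tuple V -> R :=
  drop_first (extend i phi).
Definition down_step m i (phi : m.+1.-tuple V -> R) : m.+1.-tuple V -> R :=
  extend i.+1 (drop_first phi).
Arguments up_step {m} i phi.
Arguments down_step {m} i phi.

Lemma supported_extend m i (phi : m.-tuple V -> R) : supported i (extend i phi).
Proof. by move=> u /negbTE; rewrite /extend => ->. Qed.

Lemma supported_drop_first m i (phi : m.+1.-tuple V -> R) :
  supported i phi -> supported i.+1 (drop_first phi).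
Proof.
move=> sphi r wr; apply: big1 => v _; apply: sphi; apply: contra wr.
exact: window_cons.
Qed.

Lemma supported_up m i (phi : m.-tuple V -> R) : supported i.+1 (up_step i phi).
Proof. by apply: supported_drop_first; exact: supported_extend. Qed.

Lemma supported_down m i (phi : m.+1.-tuple V -> R) :
  supported i.+1 (down_step i phi).
Proof. exact: supported_extend. Qed.

Lemma sum_drop_first m (phi : m.+1.-tuple V -> R) :
  \sum_r drop_first phi r = \sum_u phi u.
Proof. by rewrite sum_cons. Qed.

Lemma dot_up_step m i (phi psi : m.-tuple V -> R) :
  \sum_t up_step i phi t * psi t =
  \sum_(u | window i u) phi (front u) * psi (tail u).
Proof.
rewrite [RHS]big_mkcond sum_cons; apply: eq_bigr => t _.
rewrite /up_step /drop_first mulr_suml; apply: eq_bigr => v _.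
by rewrite /extend tail_cons; case: ifP => // _; rewrite mul0r.
Qed.

Lemma dot_coboundary_up j i (phi psi : j.+1.-tuple V -> R) :
  supported i phi -> supported i.+1 psi ->
  dot X (coboundary X (alt phi)) (coboundary X (alt psi)) =
  (-1) ^+ j.+1 * \sum_t up_step i phi t * psi t.
Proof.
move=> sphi spsi; rewrite (dot_coboundary_alt hA sphi spsi) dot_up_step.
congr (_ * _); rewrite [LHS]big_mkcond [RHS]big_mkcond;
  apply: eq_bigr => u _ /=.
rewrite /window; case: ifP => //= cu; case: ifP => // /negbT nu.
case: (boolP (window i (front u))) => wf; last by rewrite sphi // mul0r.
case: (boolP (window i.+1 (tail u))) => wt; last by rewrite spsi // mulr0.
case/negP: nu; apply/forallP => l; case: (unliftP ord_max l) => [l'|] ->.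
  by have := window_tnth l' wf; rewrite tnth_mktuple lift_max.
have := window_tnth ord_max wt; rewrite tnth_mktuple.
have -> : lift ord0 (@ord_max j) = ord_max by apply: val_inj; rewrite /= /bump.
by rewrite /= addSnnS.
Qed.

Lemma dot_boundary_down j i (phi psi : j.+1.-tuple V -> R) :
  supported i phi -> supported i.+1 psi ->
  dot X (boundary X (alt phi)) (boundary X (alt psi)) =
  (-1) ^+ j * \sum_t down_step i phi t * psi t.
Proof.
move=> sphi spsi; rewrite (dot_boundary_alt hA sphi spsi); congr (_ * _).
rewrite sum_snoc; apply: eq_bigr => r _; rewrite mulr_sumr.
apply: eq_bigr => w _; rewrite /down_step /extend.
case: ifPn => wr; first by rewrite front_snoc.
by rewrite spsi // !mulr0.
Qed.

Lemma altZ m a (phi : m.-tuple V ->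
  R) : alt (fun t => a * phi t) = a *: alt phi.
Proof. by rewrite /alt scaler_sumr; apply: eq_bigr => t _; rewrite scalerA. Qed.

Lemma alt_pairing_bound j i (B : form R V j.+1 -> form R V j.+1 ->
  R) (c sgn : R)
    (phi psi : j.+1.-tuple V -> R) :
  (forall a f g h, B (a *: f + g) h = a * B f h + B g h) ->
  (forall f g, B f g = B g f) ->
  (forall f, Omega X j.+1 f -> `|B f f| <= c * dot X f f) ->
  sgn ^+ 2 = 1 -> supported i phi -> supported i.+1 psi ->
  2 * (sgn * B (alt phi) (alt psi)) <=
    c * (\sum_t phi t ^+ 2 + \sum_t psi t ^+ 2).
Proof.
move=> Bl Bs Bc s1 sphi spsi.
have B0 h : B 0 h = 0.
  by have := Bl (-1) 0 0 h; rewrite scaler0 addr0 mulN1r addNr.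
have -> : sgn * B (alt phi) (alt psi) = B (sgn *: alt phi) (alt psi).
  by rewrite -[_ *: _]addr0 Bl B0 addr0.
have Ophi := Omega_alt (window_cell_supported sphi).
have Opsi := Omega_alt (window_cell_supported spsi).
have -> : \sum_t phi t ^+ 2 = dot X (sgn *: alt phi) (sgn *: alt phi).
  rewrite dotZl dotZr mulrA -expr2 s1 mul1r.
  by rewrite (dot_alt_self hA sphi).
rewrite -(dot_alt_self hA spsi).
apply: (@polarization R _ (Omega X j.+1) B (@dot R V X j.+1)) => //.
- by move=> *; rewrite dotP.
- by move=> *; rewrite dotC.
- by move=> *; exact: Omega_linear.
- exact: OmegaZ.
Qed.

(** The last hypothesis holds when [psi] is the image of [phi] under the block of [sgn * B] from
    window [i] to window [i.+1]; the conclusion then bounds the operator norm of that block. *)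
Lemma alt_operator_bound j i (B : form R V j.+1 -> form R V j.+1 ->
  R) (c sgn : R)
    (phi psi : j.+1.-tuple V -> R) :
  (forall a f g h, B (a *: f + g) h = a * B f h + B g h) ->
  (forall f g, B f g = B g f) -> 0 <= c ->
  (forall f, Omega X j.+1 f -> `|B f f| <= c * dot X f f) ->
  sgn ^+ 2 = 1 -> supported i phi -> supported i.+1 psi ->
  sgn * B (alt phi) (alt psi) = \sum_t psi t ^+ 2 ->
  \sum_t psi t ^+ 2 <= c ^+ 2 * \sum_t phi t ^+ 2.
Proof.
move=> Bl Bs c0 Bc s1 sphi spsi E; apply: sqnorm_duality => // z.
have B0 h : B 0 h = 0.
  by have := Bl (-1) 0 0 h; rewrite scaler0 addr0 mulN1r addNr.
have szphi : supported i (fun t => z * phi t).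
  by move=> t wt; rewrite sphi // mulr0.
have := alt_pairing_bound Bl Bs Bc s1 szphi spsi.
rewrite altZ -[_ *: _]addr0 Bl B0 addr0 (mulrCA sgn) E => h.
apply: le_trans h _; rewrite le_eqVlt; apply/orP; left; apply/eqP.
congr (_ * (_ + _)); rewrite mulr_sumr; apply: eq_bigr => t _; exact: exprMn.
Qed.

Section Step.
Variables (j : nat) (k kappa e : R).
Hypotheses (k0 : 0 < k) (kappa0 : 0 < kappa) (e0 : 0 <= e) (e1 : e <= 1).
Hypothesis hodge : forall f : form R V j.+1, Omega X j.+1 f ->
  k * (1 - e) * dot X f f <= hodge_form X kappa f f <= k * (1 + e) * dot X f f.

Let sgn : R := (-1) ^+ j.+1.
Let sgn2 : sgn ^+ 2 = 1.
Proof. by rewrite /sgn -exprM mulnC exprM sqrrN expr1n expr1n. Qed.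

(** The boundary half of the Hodge form is nonnegative and [e <= 1]. This is the source of the
    powers of [2 * k] below. *)
Lemma coboundary_sqnorm_le (f : form R V j.+1) : Omega X j.+1 f ->
  `|dot X (coboundary X f) (coboundary X f)| <= 2 * k * dot X f f.
Proof.
move=> Of; rewrite ger0_norm ?dot_ge0 //.
have /andP[_] := hodge Of; rewrite /hodge_form => h.
have h2 : 0 <= kappa * dot X (boundary X f) (boundary X f).
  by rewrite mulr_ge0 ?dot_ge0 // ltW.
have h3 : k * (1 + e) * dot X f f <= 2 * k * dot X f f.
  rewrite ler_wpM2r ?dot_ge0 //.
  have : k * e <= k by rewrite ler_piMr // ltW.
  lra.
lra.
Qed.

Lemma boundary_sqnorm_le (f : form R V j.+1) : Omega X j.+1 f ->
  `|kappa * dot X (boundary X f) (boundary X f)| <= 2 * k * dot X f f.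
Proof.
move=> Of; rewrite ger0_norm; last by rewrite mulr_ge0 ?dot_ge0 // ltW.
have /andP[_] := hodge Of; rewrite /hodge_form => h.
have h2 := dot_ge0 X (coboundary X f).
have h3 : k * (1 + e) * dot X f f <= 2 * k * dot X f f.
  rewrite ler_wpM2r ?dot_ge0 //.
  have : k * e <= k by rewrite ler_piMr // ltW.
  lra.
lra.
Qed.

Lemma hodge_deviation_le (f : form R V j.+1) : Omega X j.+1 f ->
  `|hodge_form X kappa f f - k * dot X f f| <= k * e * dot X f f.
Proof.
move=> /hodge/andP[h1 h2]; rewrite ler_norml; apply/andP; split; lra.
Qed.

Lemma up_step_pairing_le i (phi psi : j.+1.-tuple V -> R) :
  supported i phi -> supported i.+1 psi ->
  2 * (\sum_t up_step i phi t * psi t) <=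
    2 * k * (\sum_t phi t ^+ 2 + \sum_t psi t ^+ 2).
Proof.
move=> sphi spsi.
have <- : sgn * dot X (coboundary X (alt phi)) (coboundary X (alt psi)) =
    \sum_t up_step i phi t * psi t.
  by rewrite (dot_coboundary_up sphi spsi) mulrA -expr2 -/sgn sgn2 mul1r.
apply: (@alt_pairing_bound j i
  (fun f g => dot X (coboundary X f) (coboundary X g))) => //.
- by move=> *; rewrite coboundary_linear dotP.
- by move=> *; rewrite dotC.
- exact: coboundary_sqnorm_le.
Qed.

Lemma up_step_sqnorm_le i (phi : j.+1.-tuple V -> R) : supported i phi ->
  \sum_t up_step i phi t ^+ 2 <= (2 * k) ^+ 2 * \sum_t phi t ^+ 2.
Proof.
move=> sphi; have spsi : supported i.+1 (up_step i phi) by exact: supported_up.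
apply: (@alt_operator_bound j i
  (fun f g => dot X (coboundary X f) (coboundary X g)) (2 * k) sgn) => //.
- by move=> *; rewrite coboundary_linear dotP.
- by move=> *; rewrite dotC.
- by rewrite mulr_ge0 // ltW.
- exact: coboundary_sqnorm_le.
- by rewrite (dot_coboundary_up sphi spsi) mulrA -expr2 -/sgn sgn2 mul1r.
Qed.

Lemma down_step_sqnorm_le i (phi : j.+1.-tuple V -> R) : supported i phi ->
  \sum_t (kappa * down_step i phi t) ^+ 2 <= (2 * k) ^+ 2 * \sum_t phi t ^+ 2.
Proof.
move=> sphi.
have spsi : supported i.+1 (fun t => kappa * down_step i phi t).
  by move=> t wt; rewrite supported_down // mulr0.
apply: (@alt_operator_bound j i
  (fun f g => kappa * dot X (boundary X f) (boundary X g)) (2 * k) (- sgn)) =>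
    //.
- by move=> *; rewrite boundaryP dotP; ring.
- by move=> *; rewrite dotC.
- by rewrite mulr_ge0 // ltW.
- exact: boundary_sqnorm_le.
- by rewrite sqrrN.
- rewrite (dot_boundary_down sphi spsi) /sgn exprS mulN1r opprK.
  set S := \sum_t _.
  have -> : (-1) ^+ j * (kappa * ((-1) ^+ j * S)) = ((-1) ^+ j) ^+ 2 * (kappa
    * S) by ring.
  rewrite -exprM mulnC exprM sqrrN !expr1n mul1r.
  by rewrite mulr_sumr; apply: eq_bigr => t _; ring.
Qed.

(** The coboundary and boundary halves have blocks of opposite signs, so the block of the Hodge form
    is [sgn] times the difference of the two steps. Subtracting [k] times [dot] leaves this block
    unchanged, by [dot_alt_shift], and brings the norm down to [k * e]. *)
Lemma step_deviation_sqnorm_le i (phi : j.+1.-tuple V -> R) : supported i phi ->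
  \sum_t (up_step i phi t - kappa * down_step i phi t) ^+ 2 <=
    (k * e) ^+ 2 * \sum_t phi t ^+ 2.
Proof.
move=> sphi.
have spsi : supported i.+1 (fun t =>
  up_step i phi t - kappa * down_step i phi t).
  by move=> t wt; rewrite supported_down // supported_up // mulr0 subr0.
apply: (@alt_operator_bound j i
  (fun f g => hodge_form X kappa f g - k * dot X f g) (k * e) sgn) => //.
- by move=> *; rewrite hodge_form_linear dotP; ring.
- by move=> *; rewrite hodge_formC dotC.
- by rewrite mulr_ge0 // ltW.
- exact: hodge_deviation_le.
- rewrite (dot_alt_shift hA sphi spsi) mulr0 subr0 /hodge_form.
  rewrite (dot_coboundary_up sphi spsi) (dot_boundary_down sphi spsi).
  have -> : (-1) ^+ j = - sgn by rewrite /sgn exprS mulN1r opprK.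
  rewrite -/sgn; set P := \sum_t _; set Q := \sum_t _.
  have -> : sgn * (sgn * P + kappa * (- sgn * Q)) = sgn ^+ 2 * (P - kappa * Q)
    by ring.
  rewrite sgn2 mul1r /P /Q mulr_sumr -sumrB; apply: eq_bigr => t _; ring.
Qed.

End Step.

End Operators.

(** * Galleries *)

Section Galleries.
Variables (R : realType) (V : finType) (X : complex V) (A : nat -> {set V}).
Hypothesis hA : forall i j x, x \in A i -> x \in A j -> i = j.
Implicit Types m i : nat.
Local Notation window := (window X A).
Local Notation supported := (@window_supported R V X A).

Definition window_ind m i (t : m.-tuple V) : R := (window i t)%:R.
Definition window_count m i : R := \sum_(t : m.-tuple V) window_ind i t.

Lemma supported_ind m i : supported i (@window_ind m i).
Proof. by move=> t /negbTE; rewrite /window_ind => ->. Qed.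

Lemma window_ind_sq m i : \sum_(t : m.-tuple V) window_ind i t ^+ 2 =
  window_count m i.
Proof.
apply: eq_bigr => t _; rewrite /window_ind.
by case: (window i t); rewrite ?expr1n ?expr0n.
Qed.

Lemma window_count_ge0 m i : 0 <= window_count m i.
Proof. by apply: sumr_ge0 => t _; rewrite ler0n. Qed.

Lemma window_frontK m i (u : m.+1.-tuple V) : window i u -> window i (front u).
Proof. by move=> wu; rewrite -(snoc_front u) in wu; exact: window_snoc wu. Qed.

Lemma window_tailK m i (u : m.+1.-tuple V) : window i u -> window i.+1 (tail u).
Proof. by move=> wu; rewrite -(cons_tail u) in wu; exact: window_cons wu. Qed.

Lemma extend_ind m i : extend X A i (@window_ind m i) =1 @window_ind m.+1 i.
Proof.
move=> u; rewrite /extend /window_ind; case: ifP => // wu.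
by rewrite window_frontK.
Qed.

(** For [s > 0], [up_iter m s t] counts the vertex sequences in A 0 x ... x A (s + m - 1) that end
    with [t] and whose windows of length [m + 1] are all cells. *)
Fixpoint up_iter m s : m.-tuple V -> R :=
  if s is s'.+1 then up_step X A s' (@up_iter m s') else @window_ind m 0.
Fixpoint down_iter m s : m.+1.-tuple V -> R :=
  if s is s'.+1 then down_step X A s' (@down_iter m s') else @window_ind m.+1 0.

Lemma supported_up_iter m s : supported s (@up_iter m s).
Proof. by case: s => [|s]; [exact: supported_ind | exact: supported_up]. Qed.

Lemma supported_down_iter m s : supported s (@down_iter m s).
Proof. by case: s => [|s]; [exact: supported_ind | exact: supported_down]. Qed.

(** In the operators E and D this is (E D)^s E = E (D E)^s, because the indicator one size up is E
    of the indicator ([extend_ind]). *)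
Lemma down_iterE m s : @down_iter m s =1 extend X A s (@up_iter m s).
Proof.
elim: s => [|s IH] u; first by rewrite extend_ind.
rewrite /= /down_step /extend; case: ifP => // _.
by apply: eq_bigr => v _; exact: IH.
Qed.

Lemma sum_down_iter m s : \sum_t @down_iter m s t = \sum_t @up_iter m s.+1 t.
Proof. by rewrite sum_drop_first; apply: eq_bigr => u _; exact: down_iterE. Qed.

Section Step.
Variables (j : nat) (k kappa e : R).
Hypotheses (k0 : 0 < k) (kappa0 : 0 < kappa) (e0 : 0 <= e) (e1 : e <= 1).
Hypothesis hodge : forall f : form R V j.+1, Omega X j.+1 f ->
  k * (1 - e) * dot X f f <= hodge_form X kappa f f <= k * (1 + e) * dot X f f.

(** A tuple in window [i] is counted once when the step of the indicator of its front is paired with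
    the indicator of its tail. *)
Lemma window_count_step i :
  window_count j.+2 i <= k * (window_count j.+1 i + window_count j.+1 i.+1).
Proof.
have := up_step_pairing_le hA k0 kappa0 e1 hodge
  (@supported_ind j.+1 i) (@supported_ind j.+1 i.+1).
rewrite !window_ind_sq dot_up_step.
have -> : \sum_(u : j.+2.-tuple V | window i u) window_ind i (front u) *
  window_ind i.+1 (tail u) =
    window_count j.+2 i.
  rewrite [LHS]big_mkcond /window_count; apply: eq_bigr => u _;
    rewrite /window_ind.
  by case: ifP => // wu; rewrite window_frontK // window_tailK // mulr1.
by move=> h; rewrite -(ler_pM2l (ltr0n R 2)) // mulrA.
Qed.

Lemma up_iter_sqnorm_le (x : R) s : window_count j.+1 0 <= x ^+ 2 ->
  \sum_t @up_iter j.+1 s t ^+ 2 <= ((2 * k) ^+ s * x) ^+ 2.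
Proof.
move=> hx; elim: s => [|s IH]; first by rewrite expr0 mul1r window_ind_sq.
apply: le_trans (up_step_sqnorm_le hA k0 kappa0 e1 hodge (@supported_up_iter
  j.+1 s)) _.
have -> : ((2 * k) ^+ s.+1 * x) ^+ 2 = (2 * k) ^+ 2 * ((2 * k) ^+ s * x) ^+ 2.
  by rewrite (exprS (2 * k) s); ring.
by rewrite ler_wpM2l // sqr_ge0.
Qed.

(** With T_s the [s]-th iterate of the down step, split U^(s+1) - kappa^(s+1) T_(s+1) as (U - kappa
    T) U^s plus kappa T (U^s - kappa^s T_s). The first term costs [k * e] times the norm of U^s, the
    second [2 * k] times the previous deviation. *)
Lemma iter_deviation_sqnorm_le (x : R) s : 0 <= x ->
  window_count j.+1 0 <= x ^+ 2 ->
  \sum_t (@up_iter j.+1 s t - kappa ^+ s * @down_iter j s t) ^+ 2 <=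
    (s%:R * (2 * k) ^+ s * e * x) ^+ 2.
Proof.
move=> x0 hx; elim: s => [|s IH].
  rewrite !mul0r expr0n big1 // => t _; rewrite expr0 mul1r subrr expr0n //.
have k2 : 0 <= (2 * k) ^+ s by rewrite exprn_ge0 // mulr_ge0 // ltW.
pose psi t := @up_iter j.+1 s t - kappa ^+ s * @down_iter j s t.
have spsi : supported s psi.
  by move=> t wt; rewrite /psi supported_up_iter // supported_down_iter //
    mulr0 subr0.
have h1 := step_deviation_sqnorm_le hA k0 e0 hodge (@supported_up_iter j.+1 s).
have h2 := down_step_sqnorm_le hA k0 kappa0 e1 hodge spsi.
have {}h1 : \sum_t (up_step X A s (@up_iter j.+1 s) t -
    kappa * down_step X A s (@up_iter j.+1 s) t) ^+ 2 <= (k * e * ((2 * k) ^+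
      s * x)) ^+ 2.
  apply: le_trans h1 _; rewrite [leRHS]exprMn; apply: ler_wpM2l;
    first exact: sqr_ge0.
  exact: up_iter_sqnorm_le.
have {}h2 : \sum_t (kappa * down_step X A s psi t) ^+ 2 <=
    (2 * k * (s%:R * (2 * k) ^+ s * e * x)) ^+ 2.
  by apply: le_trans h2 _; rewrite [leRHS]exprMn; apply: ler_wpM2l;
    first exact: sqr_ge0.
have := sqnorm_triangle _ _ h1 h2.
set y1 := k * e * _; set y2 := 2 * k * _ => tri.
have y10 : 0 <= y1 by rewrite /y1 !mulr_ge0 // ltW.
have y20 : 0 <= y2 by rewrite /y2 !mulr_ge0 // ltW.
apply: (@le_trans _ _ ((y1 + y2) ^+ 2)).
  apply: le_trans (tri y10 y20); rewrite le_eqVlt; apply/orP; left; apply/eqP.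
  apply: eq_bigr => t _; congr (_ ^+ 2).
  have -> : down_step X A s psi t = down_step X A s (@up_iter j.+1 s) t -
      kappa ^+ s * down_step X A s (@down_iter j s) t.
    rewrite /down_step /extend; case: ifP => _; last by rewrite mulr0 subr0.
    by rewrite /drop_first /psi big_split /= sumrN mulr_sumr.
  by rewrite /= (exprS kappa s); ring.
have y12 : y1 + y2 <= s.+1%:R * (2 * k) ^+ s.+1 * e * x.
  rewrite -natr1 (exprS (2 * k) s) -subr_ge0 /y1 /y2.
  have -> : (s%:R + 1) * (2 * k * (2 * k) ^+ s) * e * x -
    (k * e * ((2 * k) ^+ s * x) + 2 * k * (s%:R * (2 * k) ^+ s * e * x)) =
    k * e * ((2 * k) ^+ s * x) by ring.
  exact: y10.
by rewrite ler_sqr // nnegrE ?addr_ge0 // (le_trans _ y12) // addr_ge0.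
Qed.

Lemma gallery_descent (b : R) N : (forall i, window_count j.+1 i <= b) ->
  `| \sum_t @up_iter j.+1 N t - kappa ^+ N * \sum_t @up_iter j N.+1 t | <=
    N%:R * (2 * k) ^+ N * e * b.
Proof.
move=> hb; have b0 : 0 <= b := le_trans (window_count_ge0 j.+1 0) (hb 0%N).
set x := Num.sqrt b; have x0 : 0 <= x by exact: sqrtr_ge0.
have xx : x ^+ 2 = b by rewrite sqr_sqrtr.
have hx i : window_count j.+1 i <= x ^+ 2 by rewrite xx.
have h := iter_deviation_sqnorm_le N x0 (hx 0%N).
set y := N%:R * _ * e * x in h.
have y0 : 0 <= y by rewrite /y !mulr_ge0 // exprn_ge0 // mulr_ge0 // ltW.
have -> : N%:R * (2 * k) ^+ N * e * b = y * x by rewrite /y -xx; ring.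
rewrite -sum_down_iter mulr_sumr -sumrB.
set D := (fun t => @up_iter j.+1 N t - kappa ^+ N * @down_iter j N t) in h.
(* The difference lives on window [N], so its sum is a pairing with the indicator of that window,
   whose norm is at most [x]. Together with the factor [x] of the deviation this makes the error
   linear in [b]. *)
have -> : \sum_t (@up_iter j.+1 N t - kappa ^+ N * @down_iter j N t) =
    \sum_t D t * window_ind N t.
  apply: eq_bigr => t _; rewrite /window_ind; case: (boolP (window N t)) => wt.
    by rewrite mulr1.
  by rewrite mulr0 supported_up_iter // supported_down_iter // mulr0 subr0.
have hi : \sum_t @window_ind j.+1 N t ^+ 2 <= x ^+ 2 by rewrite window_ind_sq.
rewrite ler_norml cauchy_schwarz_le // andbT lerNl -sumrN.
under eq_bigr do rewrite -mulNr.
apply: cauchy_schwarz_le => //.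
by under eq_bigr do rewrite sqrrN.
Qed.

End Step.

Lemma window1 i v (t : 0.-tuple V) : window i [tuple of v :: t] = (v \in A i).
Proof.
rewrite /window /ordered_cell.
have -> : [set x in [tuple of v :: t]]%SET = [set v]%SET.
  by apply/setP => x; rewrite !inE (tuple0 t) /= orbF.
rewrite cells_vertex (tuple0 t) /=; apply/forallP/idP => [/(_ ord0)|vA l].
  by rewrite tnth0 addn0.
by rewrite (ord1 l) tnth0 addn0.
Qed.

(** At size 0 the windows to be cells are single vertices, so every sequence in the product is
    counted. *)
Lemma up_iter0 s (t : 0.-tuple V) : @up_iter 0 s t = \prod_(l < s) #|A l|%:R.
Proof.
elim: s t => [|s IH] t.
  rewrite big_ord0 /= /window_ind /window /ordered_cell (tuple0 t) /=.
  have -> : [set x in [::]]%SET = finset.set0 :> {set V} by apply/setP => x;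
    rewrite !inE.
  by rewrite cells_set0 /=; case: forallP => // -[] [].
rewrite big_ord_recr.
rewrite -[LHS]/(\sum_v extend X A s (@up_iter 0 s) [tuple of v :: t]) /extend.
under eq_bigr do rewrite window1 IH.
by rewrite -big_mkcond /= sumr_const mulr_natr.
Qed.

Lemma sum_up_iter0 s : \sum_t @up_iter 0 s t = \prod_(l < s) #|A l|%:R.
Proof.
under eq_bigr do rewrite up_iter0.
by rewrite sumr_const card_tuple expn0.
Qed.

Lemma window_count1 i : window_count 1 i = #|A i|%:R.
Proof.
rewrite /window_count sum_cons.
under eq_bigr => t _ do under eq_bigr => v _ do rewrite /window_ind window1.
rewrite sumr_const card_tuple expn0 mulr1n -natr_sum -sum1_card.
by congr (_%:R); rewrite [RHS]big_mkcond; apply: eq_bigr => v _;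
  case: (v \in A i).
Qed.

Lemma sum_up_iter1 m : \sum_t @up_iter m 1 t = window_count m.+1 0.
Proof. by rewrite sum_drop_first; apply: eq_bigr => u _; exact: extend_ind. Qed.

End Galleries.

(** * The upper Laplacian in dimension -1 *)

Section LowerSpectrum.
Variables (R : realType) (V : finType) (X : complex V).

(** In sizes 0 and 1 the only permutation is the identity, so forms are their own alternations; each
    of the vertices then contributes one copy of [c]. *)
Lemma up_laplacian0 (c : form R V 0) : Omega X 0 c ->
  up_laplacian X c = #|V|%:R *: c.
Proof.
move=> Oc.
have perm_small m (p : 'S_m) : (m <= 1)%N -> p = 1%g.
  move=> m1; apply/permP => i; apply: val_inj.
  by move: (ltn_ord i) (ltn_ord (p i)); rewrite perm1 /=; lia.
have sc : cell_supported X c by move=> t; exact: (proj1 Oc).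
have cE : c = alt c.
  by apply/ffunP => t; rewrite alt_single // => p _; exact: perm_small.
have Od := Omega_coboundary X c.
apply/ffunP => t; rewrite /up_laplacian boundaryE // !ffunE.
under eq_bigr => v _.
  rewrite [in coboundary X c]cE coboundary_alt_tail // alt_single; last first.
    by move=> p _; exact: perm_small.
  rewrite tail_cons.
  have -> : ordered_cell X [tuple of v :: t].
    have := window1 X (fun=> [set v]%SET) 0 v t; rewrite finset.in_set1 eqxx.
    by case/andP.
  over.
by rewrite sumr_const /GRing.scale /= mulr_natl.
Qed.

End LowerSpectrum.

(** * Transversal cells and their orderings by the sets A i *)

Lemma card_transversal_cells (R : realType) (V : finType) (X : complex V) d
    (A : 'I_d.+1 -> {set V}) (A' : nat -> {set V}) :
  (forall i : 'I_d.+1, A' i = A i) ->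
  (forall i j x, x \in A' i -> x \in A' j -> i = j) ->
  window_count R X A' d.+1 0 = #|transversal_cells X A|%:R.
Proof.
move=> AE hA.
pose f (u : d.+1.-tuple V) : {set V} := [set x in u]%SET.
pose W : {set d.+1.-tuple V} := [set u | window X A' 0 u]%SET.
have win_tnth (u : d.+1.-tuple V) l : u \in W -> tnth u l \in A l.
  by rewrite inE => /(window_tnth l); rewrite add0n AE.
have disjA (i j : 'I_d.+1) x : x \in A i -> x \in A j -> i = j.
  by rewrite -!AE => h1 h2; apply: val_inj; exact: hA h1 h2.
have -> : window_count R X A' d.+1 0 = #|W|%:R.
  rewrite /window_count -natr_sum -sum1_card; congr (_%:R).
  by rewrite [RHS]big_mkcond; apply: eq_bigr => u _; rewrite inE;
    case: (window _ _ _ _).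
rewrite -(@card_in_imset _ _ f); last first.
  move=> u u' uW u'W fE; apply: eq_from_tnth => l.
  have : tnth u l \in f u' by rewrite -fE inE mem_tnth.
  rewrite inE => /tnthP[l' ll']; have := win_tnth _ l' u'W; rewrite -ll'.
  by move/(disjA _ _ _ (win_tnth _ l uW)) => E; rewrite ll' -E.
congr (#|pred_of_set _|%:R); apply/setP => s; rewrite [RHS]inE;
  apply/imsetP/idP.
  move=> [u uW ->]; have := uW; rewrite inE => /andP[/andP[uu uX] _].
  rewrite uX cardsE (card_uniqP uu) size_tuple eqxx /=; apply/forallP => i.
  apply/cards1P; exists (tnth u i); apply/setP => x; rewrite !inE.
  apply/andP/eqP => [[/tnthP[l ->] xi]|->].
    by rewrite (disjA _ _ _ xi (win_tnth _ l uW)).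
  by rewrite mem_tnth win_tnth.
case/and3P => sX /eqP sd /forallP sA.
have ex i : exists x, x \in s :&: A i.
  by have /cards1P[x E] := sA i; exists x; rewrite E finset.in_set1.
pose u : d.+1.-tuple V := [tuple xchoose (ex i) | i < d.+1].
have uP i : tnth u i \in s :&: A i by rewrite tnth_mktuple;
  exact: xchooseP (ex i).
have uA i : tnth u i \in A i by have := uP i; rewrite inE => /andP[].
have us i : tnth u i \in s by have := uP i; rewrite inE => /andP[].
have uu : uniq u.
  by apply/tuple_uniqP => i i' E; apply: (disjA _ _ (tnth u i)) => //;
    rewrite E.
have fs : f u = s.
  apply/eqP; rewrite eqEcard sd cardsE (card_uniqP uu) size_tuple leqnn andbT.
  by apply/fintype.subsetP => x; rewrite inE => /tnthP[i ->].
exists u => //; rewrite inE /window /ordered_cell uu -/(f u) fs sX /=.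
by apply/forallP => l; rewrite add0n AE.
Qed.

(** * Mixing *)

Lemma exists_cell (V : finType) (X : complex V) d m : has_dim X d ->
  (m <= d.+1)%N -> exists2 s, s \in X & #|s| = m.
Proof.
move=> [_ [s sX sd]] md; pose s' : {set V} := [set x in take m (enum s)]%SET.
exists s'.
  by apply: (cells_closed sX); apply/fintype.subsetP => x;
    rewrite inE => /mem_take; rewrite mem_enum.
rewrite cardsE (card_uniqP _) ?take_uniq ?enum_uniq // size_takel //.
by rewrite -cardE sd.
Qed.

Section Mixing.
Variables (R : realType) (V : finType) (X : complex V) (A : nat -> {set V}).
Hypothesis hA : forall i j x, x \in A i -> x \in A j -> i = j.
Variables (d : nat) (kk ee : nat -> R) (M : R).
Hypothesis hdim : has_dim X d.
(* kk m and ee m are the paper's k_{m-1} and eps_{m-1}, with k_{-1} = n and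
   eps_{-1} = 0. *)
Hypotheses (kk0 : kk 0%N = #|V|%:R) (ee0 : ee 0%N = 0).
Hypothesis hexp : forall j, (j < d)%N -> expander X j (kk j.+1) (ee j.+1).
Hypothesis hM : forall i, #|A i|%:R <= M.

Let e j := Num.max (ee j.+1) (ee j).
Let P m : R := \prod_(l < m) kk l.+1.

Let M0 : 0 <= M.
Proof. exact: le_trans (ler0n _ _) (hM 0%N). Qed.

Lemma kk_gt0 m : (m <= d)%N -> 0 < kk m.
Proof.
case: m => [_|j jd]; last first.
  by apply: expander_gt0 (hexp jd) (exists_cell hdim _); rewrite ltnS.
rewrite kk0 ltr0n; have [s _ s1] := exists_cell hdim (ltn0Sn d).
by apply: leq_trans (max_card [in s]); rewrite s1.
Qed.

Lemma ee_bounds m : (m <= d)%N -> 0 <= ee m < 1.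
Proof. by case: m => [|j /hexp[]//]; rewrite ee0 lexx ltr01. Qed.

Lemma e_bounds j : (j < d)%N -> 0 <= e j <= 1.
Proof.
move=> jd; have /andP[h1 h2] := ee_bounds jd;
  have /andP[h3 h4] := ee_bounds (ltnW jd).
by rewrite /e le_max h1 /= ge_max !ltW.
Qed.

Lemma hodge_bound j (f : form R V j.+1) : (j < d)%N -> Omega X j.+1 f ->
  kk j.+1 * (1 - e j) * dot X f f <= hodge_form X (kk j.+1 / kk j) f f
    <= kk j.+1 * (1 + e j) * dot X f f.
Proof.
move=> jd Of.
apply: (hodge_form_bound (kk_gt0 jd) (kk_gt0 (ltnW jd)) (hexp jd) _ _ _ Of);
  [| by rewrite /e le_max lexx | instantiate (1 := ee j);
    by rewrite /e le_max lexx orbT].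
move=> {f Of} h mu Oh h0 hmu.
(* For [j = 0] the eigenvalue one dimension down is exactly [kk 0]. Otherwise the boundary of [h] is
   a nonzero cycle and the previous expander hypothesis applies. *)
case: j jd h Oh h0 hmu => [|j] jd h Oh h0 hmu.
  rewrite (up_laplacian0 (Omega_boundary Oh)) in hmu.
  have -> : mu = kk 0%N.
    apply/eqP; rewrite -subr_eq0; apply/eqP.
    have : (mu - kk 0%N) *: boundary X h = 0 by rewrite scalerBl -hmu kk0 subrr.
    by move/eqP; rewrite scaler_eq0 => /orP[/eqP//|/eqP].
  by rewrite ee0 subr0 addr0 mulr1 lexx.
have [_ hs] := hexp (ltnW jd); apply: hs.
exists (boundary X h); split=> //; split; first exact: Omega_boundary.
exact: boundary_boundary.
Qed.

Lemma P_gt0 m : (m <= d)%N -> 0 < P m.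
Proof.
by move=> md; apply: prodr_gt0 => l _; apply: kk_gt0;
  exact: leq_trans (ltn_ord l) md.
Qed.

Lemma PS m : P m.+1 = P m * kk m.+1.
Proof. by rewrite /P big_ord_recr. Qed.

(** Each size costs a factor [2 * kk j.+1], since [window_count_step] adds up two windows. *)
Lemma window_count_le j i : (j <= d)%N ->
  window_count R X A j.+1 i <= 2 ^+ j * P j * M.
Proof.
elim: j i => [|j IH] i jd.
  by rewrite window_count1 /P big_ord0 expr0 !mul1r.
have /andP[_ e1] := e_bounds jd.
have k0 := kk_gt0 jd; have k'0 := kk_gt0 (ltnW jd).
apply: le_trans (window_count_step hA k0 (divr_gt0 k0 k'0) e1 (fun f =>
  hodge_bound jd) i) _.
have -> : 2 ^+ j.+1 * P j.+1 * M =
    kk j.+1 * (2 ^+ j * P j * M + 2 ^+ j * P j * M).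
  by rewrite exprS PS; ring.
by rewrite ler_pM2l // lerD // IH // ltnW.
Qed.

(* The sum counts the vertex sequences in A 0 x ... x A d all of whose windows
   of length m+1 are cells; the factor makes Q approximately constant, from the
   main term of the estimate at m = 0 to the number of transversal cells at
   m = d. *)
Let Q m : R := P d / (P m * kk m ^+ (d - m)) * \sum_t @up_iter R V X A m (d.+1
  - m) t.

Lemma Q_step j : (j < d)%N ->
  `|Q j.+1 - Q j| <= P d * (d%:R * 2 ^+ d) * (ee j.+1 + ee j) * M.
Proof.
move=> jd; have /andP[e0 e1] := e_bounds jd.
have k0 := kk_gt0 jd; have k'0 := kk_gt0 (ltnW jd).
pose N := (d - j)%N.
have NE : (d - j = (d - j.+1).+1)%N by lia.
have := gallery_descent hA k0 (divr_gt0 k0 k'0) e0 e1 (fun f =>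
  hodge_bound jd) N
  (fun i => window_count_le i (ltnW jd)).
have -> : N.+1 = (d.+1 - j)%N by rewrite /N; lia.
rewrite /Q; have -> : (d.+1 - j.+1 = N)%N by rewrite /N; lia.
set S := \sum_t _; set S' := \sum_t _ => h.
pose C := P d / (P j.+1 * kk j.+1 ^+ (d - j.+1)).
have C0 : 0 < C.
  by rewrite divr_gt0 ?P_gt0 // mulr_gt0 ?P_gt0 // exprn_gt0.
have kN : kk j.+1 ^+ N = kk j.+1 * kk j.+1 ^+ (d - j.+1) by rewrite /N NE exprS.
have Pj := P_gt0 (ltnW jd).
have kn0 : kk j.+1 ^+ (d - j.+1) != 0 by rewrite gt_eqF // exprn_gt0.
have kn0' : kk j ^+ N != 0 by rewrite gt_eqF // exprn_gt0.
(* The normalizations of [Q j] and [Q j.+1] differ exactly by the factor [kappa ^+ N] of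
   [gallery_descent], the last factor [kk j.+1] being supplied by [P j.+1]. *)
have CE : P d / (P j * kk j ^+ (d - j)) = C * (kk j.+1 / kk j) ^+ N.
  rewrite /C PS -/N expr_div_n kN; field.
  by rewrite kn0 kn0' !gt_eqF.
rewrite CE -/C -(mulrA C) -mulrBr normrM (ger0_norm (ltW C0)).
apply: le_trans (_ : C * (N%:R * (2 * kk j.+1) ^+ N * e j * (2 ^+ j * P j *
  M)) <= _).
  by rewrite ler_pM2l.
(* [C] absorbs [kk j.+1 ^+ N] and [P j] into [P d], and the powers of 2 combine because
   [N + j = d]. *)
have -> : C * (N%:R * (2 * kk j.+1) ^+ N * e j * (2 ^+ j * P j * M)) =
    P d * (N%:R * 2 ^+ d) * e j * M.
  have -> : 2 ^+ d = 2 ^+ N * 2 ^+ j :> R by rewrite -exprD subnK // ltnW.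
  rewrite /C PS exprMn kN; field.
  by rewrite kn0 !gt_eqF.
have ej : e j <= ee j.+1 + ee j.
  have /andP[h1 _] := ee_bounds jd; have /andP[h3 _] := ee_bounds (ltnW jd).
  by rewrite /e ge_max lerDl lerDr h1 h3.
have Nd : N%:R <= d%:R :> R by rewrite ler_nat leq_subr.
have PP := ltW (P_gt0 (leqnn d)).
have d2 : 0 <= 2 ^+ d :> R by rewrite exprn_ge0.
apply: ler_wpM2r => //; apply: ler_pM => //; first by rewrite !mulr_ge0.
by apply: ler_wpM2l => //; apply: ler_wpM2r.
Qed.

Lemma mixing_bound :
  `|window_count R X A d.+1 0 - P d / #|V|%:R ^+ d * \prod_(l < d.+1) #|A
    l|%:R| <=
    d%:R * 2 ^+ d.+1 * P d * (\sum_(j < d) ee j.+1) * M.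
Proof.
have -> : window_count R X A d.+1 0 = Q d.
  rewrite /Q subnn subSnn expr0 mulr1 divff ?gt_eqF ?P_gt0 // mul1r.
  by rewrite sum_up_iter1.
have -> : P d / #|V|%:R ^+ d * \prod_(l < d.+1) #|A l|%:R = Q 0.
  by rewrite /Q !subn0 sum_up_iter0 {3}/P big_ord0 mul1r kk0.
rewrite -telescope_sumr // big_mkord; apply: le_trans (ler_norm_sum _ _ _) _.
apply: (@le_trans _ _ (\sum_(j < d) P d * (d%:R * 2 ^+ d) * (ee j.+1 + ee j) *
  M)).
  by apply: ler_sum => j _; exact: Q_step.
rewrite -mulr_suml -mulr_sumr big_split /=; apply: ler_wpM2r => //.
set S := \sum_(j < d) ee j.+1; set S' := \sum_(j < d) ee j.
(* Each eps occurs in two consecutive steps of the telescoping sum, except that [ee 0] is 0; this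
   doubles the constant. *)
have SS' : S' <= S.
  rewrite /S /S'; case: (d) ee_bounds => [|d' eeb]; first by rewrite !big_ord0.
  rewrite big_ord_recl [leRHS]big_ord_recr /= ee0 add0r lerDl.
  by have /andP[] := eeb _ (leqnn d'.+1).
have PP := ltW (P_gt0 (leqnn d)).
have -> : d%:R * 2 ^+ d.+1 * P d * S = P d * (d%:R * 2 ^+ d) * (S + S).
  by rewrite exprS; ring.
by apply: ler_wpM2l; [rewrite !mulr_ge0 ?exprn_ge0 | rewrite lerD2l].
Qed.

End Mixing.

Theorem theorem1p1 (R : realType) (d : nat) (hd : (1 <= d)%N) :
  exists c : R,
    forall (V : finType) (X : complex V) (k eps : 'I_d -> R),
      has_dim X d ->
      (forall j : 'I_d, expander X j (k j) (eps j)) ->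
      forall A : 'I_d.+1 -> {set V},
        (forall i j, i != j -> [disjoint A i & A j]) ->
        `| #|transversal_cells X A|%:R
           - (\prod_(j < d) k j) / #|V|%:R ^+ d * \prod_(i < d.+1) #|A i|%:R |
        <= c * (\prod_(j < d) k j) * (\sum_(j < d) eps j)
             * (\max_(i < d.+1) #|A i|)%:R.
Proof.
(* [d] bounds the number of iterations in one descent, [2 ^+ d] comes from the crude norm and
   counting bounds, and the last 2 from the two occurrences of each eps. *)
exists (d%:R * 2 ^+ d.+1) => V X k eps hdim hexp A dA.
case: d hd k eps hdim hexp A dA => // d _ k eps hdim hexp A dA.
(* Padding with empty sets keeps the family disjoint and its sizes below the maximum, so windows may
   start at any index. *)
pose A' i := if (i < d.+2)%N then A (inord i) else finset.set0.
pose kk m := if m is m'.+1 then k (inord m') else #|V|%:R : R.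
pose ee m := if m is m'.+1 then eps (inord m') else 0 : R.
have AE (i : 'I_d.+2) : A' i = A i by rewrite /A' ltn_ord inord_val.
have hA i j x : x \in A' i -> x \in A' j -> i = j.
  rewrite /A'; case: ifP => id; last by rewrite finset.in_set0.
  case: ifP => jd; last by rewrite finset.in_set0.
  move=> xi xj; apply/eqP; apply/negPn/negP => ij.
  have nij : inord i != inord j :> 'I_d.+2.
    by apply: contra ij => /eqP/(congr1 val); rewrite /= !inordK // => ->.
  by have := disjointFr (dA _ _ nij) xi; rewrite xj.
have hexp' j : (j < d.+1)%N -> expander X j (kk j.+1) (ee j.+1).
  by move=> jd; have := hexp (inord j); rewrite inordK.
have hM i : #|A' i|%:R <= (\max_(i < d.+2) #|A i|)%:R :> R.
  rewrite ler_nat /A'; case: ifP => _; last by rewrite cards0.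
  exact: leq_bigmax.
have := mixing_bound hA hdim (erefl : kk 0%N = _) (erefl : ee 0%N = _) hexp' hM.
rewrite (card_transversal_cells R X AE hA).
have -> : \prod_(l < d.+1) kk l.+1 = \prod_(j < d.+1) k j.
  by apply: eq_bigr => l _; rewrite /kk inord_val.
have -> : \sum_(l < d.+1) ee l.+1 = \sum_(j < d.+1) eps j.
  by apply: eq_bigr => l _; rewrite /ee inord_val.
by have -> : \prod_(l < d.+2) #|A' l|%:R = \prod_(i < d.+2) #|A i|%:R :> R
  by apply: eq_bigr => l _; rewrite AE.
Qed.
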